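(* There is an isometric isomorphism between $\mathcal Q$ (the space of quasi-martingales, normed by $\|\cdot\|_{\mathcal Q}$, where processes differing by a martingale are identified) and $\mathscr M^{loc}$ (the locally countably additive elements of $ba(\bar{\mathscr F})$, normed by total variation) determined by the identity $$x(f)=-\mathop{\mathrm{LIM}}_{d\in\mathscr D}\ P\int \mathscr P^d(f)\,dX\qquad \text{for all } f\in\mathfrak B(\bar{\mathscr F}).\qquad ( * )$$ In particular: (i) each $x\in\mathscr M^{loc}$ corresponds via $( * )$ to one and only one (up to modification) integrable quasi-potential $X$; (ii) $x\in\mathscr M^{loc}_+$ if and only if $x$ corresponds via $( * )$ to an integrable potential.
   Context: Setting. $(\Omega,\mathscr F,P)$ is a probability space, $P(\cdot)$ also denotes expectation and $P(\cdot|\mathscr G)$ conditional expectation. $\Delta$ is a linearly ordered set and $(\mathscr F_\delta:\delta\in\Delta)$ an increasing family of sub $\sigma$-algebras of $\mathscr F$ (no right continuity assumed); all $\sigma$-algebras include the corresponding $P$-null sets. $\bar\Omega=\Omega\times\Delta$; $\bar{\mathscr F}$ is the augmentation of $\mathscr F\otimes 2^\Delta$ with respect to sets with $P$-null projection on $\Omega$. $\mathfrak B(\cdot)$ denotes the bounded functions measurable with respect to the indicated family, with the sup norm. $]\delta_1,\delta_2]=\{\delta\in\Delta:\delta_1<\delta\le\delta_2\}$ (possibly empty); it is also identified with $\Omega\times]\delta_1,\delta_2]$. All processes $X=(X_\delta:\delta\in\Delta)$ are adapted ($X_\delta$ is $\mathscr F_\delta$-measurable). Two processes $X,Y$ are considered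 equal (up to modification) if $P(X_\delta=Y_\delta)=1$ for all $\delta$. A process is integrable if $\sup_{\delta}P(|X_\delta|)<\infty$. $\mathscr D$ is the collection of finite subsets $d=\{\delta_1\le\ldots\le\delta_{N+1}\}$ of $\Delta$, directed by inclusion. For such $d$, $$\mathscr P^d=\Big\{\bigcup_{n=1}^N F_n\times]\delta_n,\delta_{n+1}]:F_n\in\mathscr F_{\delta_n},\ n=1,\ldots,N\Big\},$$ so $\mathfrak B(\mathscr P^d)$ consists of the functions $\sum_{n=1}^N h_n\mathbf 1_{]\delta_n,\delta_{n+1}]}$ with $h_n\in\mathfrak B(\mathscr F_{\delta_n})$. The symbol $\mathscr P^d$ also denotes the operator $\mathscr P^d:\mathfrak B(\bar{\mathscr F})\to\mathfrak B(\mathscr P^d)$, $\mathscr P^d(U)=\sum_{n=1}^N P(U_{\delta_{n+1}}|\mathscr F_{\delta_n})\mathbf 1_{]\delta_n,\delta_{n+1}]}$. For $h=\sum_n h_n\mathbf 1_{]\delta_n,\delta_{n+1}]}\in\mathfrak B(\mathscr P^d)$, $\int h\,dX=\sum_n h_n(X_{\delta_{n+1}}-X_{\delta_n})$, and $P\int h\,dX=\sum_n P\big(h_n(P(X_{\delta_{n+1}}|\mathscr F_{\delta_n})-X_{\delta_n})\big)$. $\mathrm{LIM}_{d\in\mathscr D}$ is a (fixed) Banach limit on bounded nets indexed by $\mathscr D$: a positive linear functional extending the ordinary limit. Quasi-martingales. For $d=\{\delta_1,\ldots,\delta_{N+1}\}$ the $d$-variation of $X$ is $V^d(X)=\sum_{n=1}^N|X_{\delta_n}-P(X_{\delta_{n+1}}|\mathscr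 F_{\delta_n})|$. $X$ is a quasi-martingale if $\|X\|_{\mathcal Q}=\sup\{P(V^d(X)):d\in\mathscr D\}<\infty$ (integrability of $X$ is not required). A quasi-potential is a quasi-martingale $X$ for which there is a sequence $(\delta_n)_{n\in\mathbb N}$ in $\Delta$ such that $\lim_nP(|X_{\bar\delta_n}|)=0$ for every sequence $(\bar\delta_n)$ in $\Delta$ with $\bar\delta_n\ge\delta_n$ for all $n$. A potential is a process that is both a quasi-potential and a positive supermartingale. Measures. $ba(\bar{\mathscr F})$ is the space of bounded finitely additive (signed) measures on $\bar{\mathscr F}$ with the total variation norm; $x(f)$ denotes the integral of $f$. $x\in ba(\bar{\mathscr F})$ is locally countably additive, $x\in\mathscr M^{loc}$, if the restriction of $x$ to $\mathscr P^d$ is countably additive for each $d\in\mathscr D$; $\mathscr M^{loc}_+$ is the set of its nonnegative elements.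
   Formalization: As stated, M^loc is too large: mass on Ω×{min Δ} violates ( * ). Here x must vanish on sets with P-null projection and satisfy x(f)=LIM x(P^d(f)), both forced by ( * ). Each x in M^loc vanishing on those sets agrees on all P^d with exactly one such measure. *)

(* Defs.v *)
From mathcomp Require Import all_boot all_order all_algebra finmap.
From mathcomp Require Import all_classical all_reals all_analysis.
Set Implicit Arguments.
Unset Strict Implicit.
Unset Printing Implicit Defensive.
Import Order.TTheory GRing.Theory Num.Theory.
Import numFieldNormedType.Exports.
Local Open Scope classical_set_scope.
Local Open Scope ring_scope.

Definition measurable_wrt {R : realType} {T : Type} (G : set (set T))
    (f : T -> R) : Prop :=
  forall B : set R, measurable B -> G (f @^-1` B).

(* The space of bounded G-measurable real functions *)
Definition bounded_measurable {R : realType} {T : Type} (G : set (set T))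
    (f : T -> R) : Prop :=
  measurable_wrt G f /\ [bounded f p | p in setT].

Section finitely_additive_integral.
Context {R : realType} {T : Type}.
Implicit Types (x : set T -> R) (f : T -> R).

(* The summand vanishes unless r is a value of f (as soon as x set0 = 0). *)
Definition simple_integral x f : R :=
  \sum_(r \in [set: R]) r * x (f @^-1` [set r]).

Definition dyadic_step f (n : nat) : T -> R :=
  fun p => (Num.floor (2 ^+ n * f p))%:~R / 2 ^+ n.

(* For f bounded, the dyadic_step f n are simple and converge uniformly to f,
   so this is the usual integral of a bounded measurable f with respect to a
   bounded finitely additive x. *)
Definition fa_integral x f : R :=
  lim (simple_integral x (dyadic_step f n) @[n --> \oo]).

(* total variation over the finite partitions made of sets of G *)
Definition fa_variation (G : set (set T)) x : \bar R :=
  ereal_sup [set v : \bar R | exists n (A : 'I_n -> set T),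
    [/\ forall i, G (A i), trivIset setT A & v = (\sum_(i < n) `|x (A i)|)%:E]].

Definition countably_additive_on (G : set (set T)) x : Prop :=
  forall A : nat -> set T, (forall n, G (A n)) -> trivIset setT A ->
    G (\bigcup_n A n) ->
    \sum_(0 <= k < n) x (A k) @[n --> \oo] --> x (\bigcup_n A n).

Definition agree_on (G : set (set T)) (x y : set T -> R) : Prop :=
  forall A, G A -> x A = y A.

Definition nonneg_on (G : set (set T)) x : Prop := forall A, G A -> 0 <= x A.

End finitely_additive_integral.

Section banach_limit.
Context {R : realType} {dD : Order.disp_t} {Delta : orderType dD}.
Implicit Types (u v : {fset Delta} -> R) (d : {fset Delta}).

Definition fset_filter : set_system {fset Delta} :=
  filter_from [set: {fset Delta}] (fun d0 => [set d | fsubset d0 d]).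

Definition banach_limit (L : ({fset Delta} -> R) -> R) : Prop :=
  [/\ forall (a : R) u v, [bounded u d | d in setT] ->
        [bounded v d | d in setT] ->
        L (fun d => a * u d + v d) = a * L u + L v,
      forall u, [bounded u d | d in setT] -> (forall d, 0 <= u d) -> 0 <= L u
    & forall u (l : R), [bounded u d | d in setT] ->
        u @ fset_filter --> l -> L u = l].

(* The pairs (delta_n, delta_(n+1)) for d = {delta_1 < ... < delta_(N+1)} *)
Definition steps d : seq (Delta * Delta) :=
  let s := sort <=%O (enum_fset d) in zip s (behead s).

End banach_limit.

Section conditional_expectation.
Context {dO : measure_display} {Omega : measurableType dO} {R : realType}.
Variable P : probability Omega R.
Implicit Types (G : set (set Omega)) (Y Z : Omega -> R).

Definition integrable_rv Y : Prop := P.-integrable setT (EFin \o Y).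

Definition is_cond_exp G Y Z : Prop :=
  [/\ measurable_wrt G Z, integrable_rv Z &
      forall A, G A -> \int[P]_(w in A) Z w = \int[P]_(w in A) Y w].

(* A chosen version of the conditional expectation, P-a.s. unique; for Y
   bounded the version is chosen with the same bounds, so that it is a bounded
   function and not only an a.s. bounded one. *)
Definition cond_exp G Y : Omega -> R :=
  xget (fun=> 0) [set Z | is_cond_exp G Y Z /\
    forall M : R, (forall w, `|Y w| <= M) -> forall w, `|Z w| <= M].

End conditional_expectation.

Section processes.
Context {dO : measure_display} {Omega : measurableType dO} {R : realType}.
Context {dD : Order.disp_t} {Delta : orderType dD}.
Variables (P : probability Omega R) (F : Delta -> set (set Omega)).
Implicit Types (X Y : Delta -> Omega -> R) (d : {fset Delta}).
Implicit Types (x y : set (Omega * Delta) -> R) (f : Omega * Delta -> R).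

Definition filtration : Prop :=
  [/\ forall t, sigma_algebra setT (F t),
      forall t, F t `<=` measurable,
      forall s t, (s <= t)%O -> F s `<=` F t
    & forall t N, P.-negligible N -> F t N].

(* Sets whose projection on Omega is P-null *)
Definition evanescent : set (set (Omega * Delta)) :=
  [set E | P.-negligible (fst @` E)].

(* The product of the sigma-algebra of Omega and the power set of Delta,
   augmented by the evanescent sets *)
Definition barF : set (set (Omega * Delta)) :=
  <<s [set A `*` D | A in measurable & D in [set: set Delta]]
      `|` evanescent >>.

Definition adapted X : Prop := forall t, measurable_wrt (F t) (X t).

(* Adapted processes whose conditional expectations make sense; this is
   pointwise in t, unlike bounded_in_L1. *)
Definition L1_process X : Prop :=
  adapted X /\ forall t, integrable_rv P (X t).

Definition modification X Y : Prop :=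
  forall t, P [set w | X t w = Y t w] = 1%E.

Definition bounded_in_L1 X : Prop :=
  (ereal_sup [set \int[P]_w `|X t w|%:E | t in [set: Delta]] < +oo)%E.

Definition martingale X : Prop :=
  L1_process X /\
  forall s t, (s <= t)%O -> is_cond_exp P (F s) (X t) (X s).

Definition supermartingale X : Prop :=
  L1_process X /\
  forall s t, (s <= t)%O ->
    {ae P, forall w, cond_exp P (F s) (X t) w <= X s w}.

Definition d_variation d X (w : Omega) : R :=
  \sum_(st <- steps d) `|X st.1 w - cond_exp P (F st.1) (X st.2) w|.

Definition quasi_norm X : \bar R :=
  ereal_sup [set (\int[P]_w (d_variation d X w)%:E)%E | d in [set: {fset Delta}]].

Definition quasi_martingale X : Prop :=
  L1_process X /\ (quasi_norm X < +oo)%E.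

Definition quasi_potential X : Prop :=
  quasi_martingale X /\
  exists u : nat -> Delta, forall v : nat -> Delta,
    (forall n, (u n <= v n)%O) ->
    \int[P]_w `|X (v n) w| @[n --> \oo] --> (0 : R).

Definition potential X : Prop :=
  [/\ quasi_potential X, supermartingale X
    & forall t, {ae P, forall w, 0 <= X t w}].

(* The family P^d; the set F_n is indexed by delta_n rather than by n. *)
Definition elementary_sets d : set (set (Omega * Delta)) :=
  [set A | exists2 H : Delta -> set Omega, (forall t, F t (H t)) &
    A = \bigcup_(st in [set` steps d]) (H st.1 `*` `]st.1, st.2]%classic)].

(* The operator P^d *)
Definition elementary_proj d f : Omega * Delta -> R :=
  fun p => \sum_(st <- steps d)
    cond_exp P (F st.1) (fun w => f (w, st.2)) p.1 *
    \1_(`]st.1, st.2]%classic : set Delta) p.2.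

(* For h = \sum_n h_n 1_]delta_n, delta_(n+1)], h_n is h (., delta_(n+1)). *)
Definition elementary_integral d (h : Omega * Delta -> R) X (w : Omega) : R :=
  \sum_(st <- steps d) h (w, st.2) * (X st.2 w - X st.1 w).

(* Bounded finitely additive measures on barF, extended arbitrarily outside
   barF; functions and sets being taken up to evanescence (as they have to be
   for P^d to be an operator), these vanish on evanescent sets. *)
Definition ba x : Prop :=
  [/\ forall A B, barF A -> barF B -> A `&` B = set0 ->
        x (A `|` B) = x A + x B,
      exists M : R, forall A, barF A -> `|x A| <= M
    & forall A, evanescent A -> x A = 0].

Definition Mloc x : Prop :=
  ba x /\ forall d, countably_additive_on (elementary_sets d) x.

Definition locally_equal x y : Prop :=
  forall d, agree_on (elementary_sets d) x y.

Variable L : ({fset Delta} -> R) -> R.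

(* x(f) = - LIM_d P \int P^d(f) dX for every bounded barF-measurable f *)
Definition corresponds x X : Prop :=
  forall f, bounded_measurable barF f ->
    fa_integral x f =
    - L (fun d => \int[P]_w elementary_integral d (elementary_proj d f) X w).

(* The elements of Mloc that are determined by their restrictions to the
   families P^d, through x(f) = LIM_d x(P^d(f)). A measure x for which
   [corresponds x X] holds is necessarily of this kind, its value at f being a
   function of the P^d(f) alone; a general element of Mloc is not, e.g. one
   carried by Omega x {t} with t the least element of Delta vanishes on all
   P^d without being 0. Each class of Mloc modulo locally_equal has exactly
   one such element. *)
Definition Mloc_lim x : Prop :=
  Mloc x /\ forall f, bounded_measurable barF f ->
    fa_integral x f = L (fun d => fa_integral x (elementary_proj d f)).

End processes.

(* Main.v *)
From HB Require Import structures.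
Require Import Defs.
From mathcomp Require Import all_boot all_order all_algebra finmap.
From mathcomp Require Import all_classical all_reals all_analysis.
From mathcomp Require Import measurable_realfun.
From mathcomp Require Import ring lra.
Import Order.TTheory GRing.Theory Num.Theory.
Import numFieldNormedType.Exports.
Set Implicit Arguments.
Unset Strict Implicit.
Unset Printing Implicit Defensive.
Local Open Scope classical_set_scope.
Local Open Scope ring_scope.

(** The whole correspondence rests on one identity. For [s <= t] put
    [drift X s t = P(X_t | F_s) - X_s]. Since conditional expectation is
    self-adjoint, it can be moved from [f] to the increments of [X]:
    [P \int P^d(f) dX = \sum_n P(f_(delta_(n+1)) drift X delta_n delta_(n+1))]
    ([approx_pairingE]). The right-hand side is linear in [f], it is bounded by
    [sup |f|] times [P(V^d(X))], and it only sees [f] up to evanescence. Hence for a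
    quasi-martingale [X] the formula [f |-> - LIM_d P \int P^d(f) dX] is a bounded
    linear functional, and its values on indicators form a bounded finitely
    additive measure, [qm_measure]; [fa_integral_functional] recovers the
    functional as the integral against this measure.

    If [H] is in [F_s] and [d] contains [s] and [t], the sum above telescopes for
    [f = 1_(H * ]s, t])], so the net is eventually constant and the measure gives the
    strip [H * ]s, t]] the mass [P(1_H (X_s - X_t))] ([qm_measure_increments]). This
    yields countable additivity on each [P^d], and shows that two quasi-martingales
    have the same measure exactly when their difference is a martingale. Splitting
    the steps of [d] by the sign of the drift writes [P(V^d(X))] as a difference of
    two values of the measure ([d_variation_witness]), which is the inequality that
    completes the isometry.

    Conversely, let [x] be locally countably additive. Because [x] is bounded, almost
    no mass is left beyond a suitable [u n] ([ba_tail]), so [x(H * ]t, u n \/ t])]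
    converges as [n] grows, uniformly in [H]. The limit is countably additive in [H]
    on [F_t] and vanishes on null sets; its density is [X_t]
    ([potential_of_measure]). By construction [X] gives the strips the same masses as
    [x], and it tends to 0 in mean along [u], that is, [X] is a quasi-potential.
    A measure satisfying [x(f) = LIM_d x(P^d(f))] is determined by its values on
    elementary sets ([Mloc_lim_unique]), so [x] is the measure of [X]. Uniqueness
    holds because a martingale has nondecreasing mean absolute value, so it
    vanishes if it is a difference of two quasi-potentials. Positive measures
    correspond to nonpositive drifts, that is, to supermartingales, and the densities
    [X_t] of their limits are positive. *)

(** * Functions measurable with respect to a sub-sigma-algebra *)

Lemma boundedP {R : realType} {T : Type} (f : T -> R) :
  [bounded f p | p in setT] <-> exists M, forall p, `|f p| <= M.
Proof.
split=> [[M [_ hM]]|[M hM]].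
  by exists (M + 1) => p; apply: hM => //; rewrite ltrDl.
exists M; split; first exact: num_real.
by move=> N MN p _; exact: le_trans (hM p) (ltW MN).
Qed.

Section sub_sigma_algebra_functions.
Context {R : realType} {T : Type}.
Variable G : set (set T).
Hypothesis sG : sigma_algebra setT G.

Lemma sigma_setC A : G A -> G (~` A).
Proof. by case: sG => _ h _ /h; rewrite setTD. Qed.

Lemma sigma_setT : G setT.
Proof. by rewrite -setC0; apply: sigma_setC; case: sG. Qed.

Lemma sigma_setU A B : G A -> G B -> G (A `|` B).
Proof.
move=> GA GB; rewrite -bigcup2E; case: sG => G0 _; apply.
by move=> [|[|n]].
Qed.

Lemma sigma_setI A B : G A -> G B -> G (A `&` B).
Proof.
by move=> GA GB; rewrite -[_ `&` _]setCK setCI; apply/sigma_setC/sigma_setU;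
  exact: sigma_setC.
Qed.

(** All closure properties of [measurable_wrt] that are needed are instances of
    composition with a Borel function of two variables. *)
Lemma measurable_wrt_comp2 (phi : R * R -> R) (f g : T -> R) :
  measurable_fun setT phi -> measurable_wrt G f -> measurable_wrt G g ->
  measurable_wrt G (fun p => phi (f p, g p)).
Proof.
move=> mphi mf mg.
have [T0|/existsNP[p _]] := pselect (forall p : T, False).
  move=> B _; rewrite (_ : _ @^-1` B = set0); first by case: sG.
  by apply/seteqP; split=> // p; case: (T0 p).
(* The measurable types of the library are pointed, so a bare type with a
   sigma-algebra becomes one only after a point has been chosen. *)
pose cT : choiceType := HB.pack T (gen_eqMixin T) (gen_choiceMixin T).
pose pT : pointedType := HB.pack T (Choice.on cT) (isPointed.Build T p).
pose S := @g_sigma_algebraType pT G.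
have mS (h : T -> R) : measurable_wrt G h <-> measurable_fun setT (h : S -> R).
  split=> [mh _ B mB|mh B mB]; rewrite ?setTI.
    by apply: sub_sigma_algebra; exact: mh.
  by have := mh measurableT B mB; rewrite setTI /measurable /= sigma_algebra_id.
apply/mS; apply: (measurableT_comp mphi).
by apply: measurable_fun_pair; exact/mS.
Qed.

Lemma measurable_wrt_cst (r : R) : measurable_wrt G (fun=> r).
Proof.
move=> B _; have [Br|nBr] := pselect (B r).
  by rewrite (_ : _ @^-1` B = setT); [exact: sigma_setT|by apply/seteqP; split].
rewrite (_ : _ @^-1` B = set0); first by case: sG.
by apply/seteqP; split.
Qed.

Lemma measurable_wrt_comp (phi : R -> R) (f : T -> R) :
  measurable_fun setT phi -> measurable_wrt G f ->
  measurable_wrt G (fun p => phi (f p)).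
Proof.
move=> mphi mf; apply: (@measurable_wrt_comp2 (phi \o fst) f f) => //.
exact: measurableT_comp.
Qed.

Lemma measurable_wrtD (f g : T -> R) : measurable_wrt G f ->
  measurable_wrt G g -> measurable_wrt G (fun p => f p + g p).
Proof.
apply: (@measurable_wrt_comp2 (fun u => u.1 + u.2)).
by apply: measurable_funD; [exact: measurable_fst|exact: measurable_snd].
Qed.

Lemma measurable_wrtM (f g : T -> R) : measurable_wrt G f ->
  measurable_wrt G g -> measurable_wrt G (fun p => f p * g p).
Proof.
apply: (@measurable_wrt_comp2 (fun u => u.1 * u.2)).
by apply: measurable_funM; [exact: measurable_fst|exact: measurable_snd].
Qed.

Lemma measurable_wrtB (f g : T -> R) : measurable_wrt G f ->
  measurable_wrt G g -> measurable_wrt G (fun p => f p - g p).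
Proof.
apply: (@measurable_wrt_comp2 (fun u => u.1 - u.2)).
by apply: measurable_funB; [exact: measurable_fst|exact: measurable_snd].
Qed.

Lemma measurable_wrt_indic (A : set T) :
  G A -> measurable_wrt G (\1_A : T -> R).
Proof.
move=> GA B mB; rewrite preimage_indic.
case: ifPn => _; case: ifPn => _ //.
- exact: sigma_setT.
- exact: sigma_setC.
- by case: sG.
Qed.

Lemma bounded_measurable_cst (r : R) : bounded_measurable G (fun=> r).
Proof.
split; first exact: measurable_wrt_cst.
by apply/boundedP; exists `|r|.
Qed.

Lemma bounded_measurableD (f g : T -> R) : bounded_measurable G f ->
  bounded_measurable G g -> bounded_measurable G (fun p => f p + g p).
Proof.
move=> [mf /boundedP[M hM]] [mg /boundedP[N hN]].
split; first exact: measurable_wrtD.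
apply/boundedP; exists (M + N) => p.
by rewrite (le_trans (ler_normD _ _))// lerD.
Qed.

Lemma bounded_measurableM (f g : T -> R) : bounded_measurable G f ->
  bounded_measurable G g -> bounded_measurable G (fun p => f p * g p).
Proof.
move=> [mf /boundedP[M hM]] [mg /boundedP[N hN]].
split; first exact: measurable_wrtM.
by apply/boundedP; exists (M * N) => p; rewrite normrM ler_pM.
Qed.

Lemma bounded_measurable_sum (I : Type) (s : seq I) (f : I -> T -> R) :
  (forall i, bounded_measurable G (f i)) ->
  bounded_measurable G (fun p => \sum_(i <- s) f i p).
Proof.
move=> mf; elim: s => [|i s ih].
  under [X in bounded_measurable _ X]eq_fun do rewrite big_nil.
  exact: bounded_measurable_cst.
under [X in bounded_measurable _ X]eq_fun do rewrite big_cons.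
exact: bounded_measurableD.
Qed.

Lemma bounded_measurable_indic (A : set T) :
  G A -> bounded_measurable G (\1_A : T -> R).
Proof.
move=> GA; split; first exact: measurable_wrt_indic.
by apply/boundedP; exists 1 => p; rewrite indicE ger0_norm// lern1; case: (_ \in _).
Qed.

End sub_sigma_algebra_functions.

(** * Integration against finitely additive measures *)

Section dyadic.
Context {R : realType} {T : Type}.
Implicit Type f : T -> R.

Lemma dyadic_step_close f n p :
  `|f p - dyadic_step f n p| <= (2^-1) ^+ n.
Proof.
have e0 : (0 : R) < 2 ^+ n by rewrite exprn_gt0.
rewrite /dyadic_step ler_norml exprVn.
have /andP[h1 h2] := floor_itv (2 ^+ n * f p).
set k := (Num.floor _)%:~R in h1 *; rewrite intrD in h2.
rewrite -(ler_pM2l e0) -[X in _ && X](ler_pM2l e0) mulrBr mulrCA divff ?gt_eqF//.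
rewrite mulr1 mulrN divff ?gt_eqF// lerBrDr lerBlDr addrC (addrC 1) (ltW h2).
by rewrite lerBlDr (le_trans h1)// lerDl.
Qed.

Lemma finite_range_dyadic_step f n : [bounded f p | p in setT] ->
  finite_set (range (dyadic_step f n)).
Proof.
move=> /boundedP[M fM].
have e0 : (0 : R) < 2 ^+ n by rewrite exprn_gt0.
pose K := (Num.truncn (2 ^+ n * M + 1)).+1.
have MK : 2 ^+ n * M + 1 < K%:R by exact: truncnS_gt.
apply: (@sub_finite_set _ _
  ((fun i : nat => ((i%:Z - K%:Z)%:~R / 2 ^+ n : R)) @` `I_(K + K))); last first.
  exact/finite_image/finite_II.
move=> _ [p _ <-]; rewrite /dyadic_step.
have /andP[h1 h2] := floor_itv (2 ^+ n * f p).
have : - (2 ^+ n * M) <= 2 ^+ n * f p <= 2 ^+ n * M.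
  by rewrite -mulrN !ler_pM2l// -ler_norml.
set k := Num.floor _ in h1 h2 *; rewrite intrD in h2.
move=> /andP[h3 h4].
(* The numerators [k] lie between [- K] and [K], and are shifted by [K] to index
   them by natural numbers. *)
have k1 : - K%:Z <= k.
  by rewrite -(ler_int R) intrN -pmulrn; lra.
have k2 : k < K%:Z.
  by rewrite -(ltr_int R) -pmulrn; lra.
exists (absz (k + K%:Z)); last first.
  by rewrite gez0_abs ?addrK// -lerBlDr sub0r.
rewrite /= -ltz_nat gez0_abs; last by rewrite -lerBlDr sub0r.
by rewrite PoszD ltrD2r.
Qed.

Lemma measurable_wrt_dyadic_step (G : set (set T)) f n : sigma_algebra setT G ->
  measurable_wrt G f -> measurable_wrt G (dyadic_step f n).
Proof.
move=> sG; apply: (@measurable_wrt_comp R T G sG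
  (fun x => (Num.floor (2 ^+ n * x))%:~R / 2 ^+ n)).
apply: nondecreasing_measurable => // x y xy.
rewrite ler_pM2r ?invr_gt0 ?exprn_gt0// ler_int; apply: le_floor.
by rewrite ler_pM2l ?exprn_gt0.
Qed.

End dyadic.

Section finitely_additive.
Context {R : realType} {T : Type}.
Variable G : set (set T).
Hypothesis sG : sigma_algebra setT G.
Implicit Types (f : T -> R) (x : set T -> R).

(** An axiomatic form of integration: every functional of this kind is the integral
    against the set function that it defines on indicators, see
    [fa_integral_functional]. *)
Definition bounded_functional (S : (T -> R) -> R) : Prop :=
  [/\ forall a f g, bounded_measurable G f -> bounded_measurable G g ->
        S (fun p => a * f p + g p) = a * S f + S g
    & exists C, forall f M, bounded_measurable G f ->
        (forall p, `|f p| <= M) -> `|S f| <= C * M].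

Lemma finite_range_decomp f : finite_set (range f) ->
  exists2 s : {fset R}, range f = [set` s] &
  f = fun p => \sum_(r <- s) r * \1_(f @^-1` [set r]) p.
Proof.
move=> /finite_fsetP[s fs]; exists s => //; apply/funext => p.
have ps : f p \in s by have : range f (f p) by [exists p]; rewrite fs.
rewrite (big_fsetD1 (f p))//= indicE mem_set//= mulr1 big_seq big1 ?addr0// => r.
rewrite !inE => /andP[rp _]; rewrite indicE memNset ?mulr0// => /= pr.
by rewrite pr eqxx in rp.
Qed.

Lemma simple_integralE x f (s : {fset R}) : x set0 = 0 ->
  range f `<=` [set` s] ->
  simple_integral x f = \sum_(r <- s) r * x (f @^-1` [set r]).
Proof.
move=> x0 fs; rewrite /simple_integral (@fsbigTE _ _ _ _ s)// => r rs.
rewrite (_ : _ @^-1` _ = set0) ?x0 ?mulr0//.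
apply/seteqP; split => // p /= pr; move: rs; rewrite -pr.
by have -> : f p \in s by exact/fs/imageT.
Qed.

(** Only the values of [x] on [G] matter, because the level sets of the dyadic
    approximations of [f] belong to [G]. *)
Lemma fa_integral_agree x y f : agree_on G x y -> bounded_measurable G f ->
  fa_integral x f = fa_integral y f.
Proof.
move=> xy [mf bf].
have E n : simple_integral x (dyadic_step f n) =
           simple_integral y (dyadic_step f n).
  rewrite /simple_integral; apply: (@eq_fsbigr _ _ +%R) => r _.
  by rewrite xy//; exact: (measurable_wrt_dyadic_step n sG mf).
by rewrite /fa_integral; under eq_fun do rewrite E.
Qed.

Section bounded_functional_theory.
Variable S : (T -> R) -> R.
Hypothesis hS : bounded_functional S.

Lemma bounded_functional0 : S (fun=> 0) = 0.
Proof.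
case: hS => _ [C hC]; apply/eqP; rewrite -normr_le0.
have := hC (fun=> 0) 0 (bounded_measurable_cst sG 0).
by rewrite mulr0; apply => p; rewrite normr0.
Qed.

Lemma bounded_functionalZ a f : bounded_measurable G f ->
  S (fun p => a * f p) = a * S f.
Proof.
move=> mf; case: hS => lS _.
have := lS a f (fun=> 0) mf (bounded_measurable_cst sG 0).
by rewrite bounded_functional0 addr0 => <-; congr S; apply/funext => p; rewrite addr0.
Qed.

Lemma bounded_functionalD f g : bounded_measurable G f ->
  bounded_measurable G g -> S (fun p => f p + g p) = S f + S g.
Proof.
move=> mf mg; case: hS => lS _; rewrite -[S f]mul1r -lS//.
by congr S; apply/funext => p; rewrite mul1r.
Qed.

Lemma bounded_functional_sum (I : Type) (s : seq I) (f : I -> T -> R) :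
  (forall i, bounded_measurable G (f i)) ->
  S (fun p => \sum_(i <- s) f i p) = \sum_(i <- s) S (f i).
Proof.
move=> mf; elim: s => [|i s ih].
  rewrite big_nil; transitivity (S (fun=> 0)); last exact: bounded_functional0.
  by congr S; apply/funext => p; rewrite big_nil.
rewrite big_cons -ih -bounded_functionalD//; last exact: bounded_measurable_sum.
by congr S; apply/funext => p; rewrite big_cons.
Qed.

(** On the dyadic approximations of [f], which have finitely many values, the simple
    integral and [S] agree by linearity; both sides then pass to the uniform limit. *)
Lemma fa_integral_functional f : bounded_measurable G f ->
  fa_integral (fun A => S \1_A) f = S f.
Proof.
move=> bmf; have [mf bf] := bmf.
have bm n : bounded_measurable G (dyadic_step f n).
  split; first exact: measurable_wrt_dyadic_step.
  case/boundedP: bf => M fM; apply/boundedP; exists ((2^-1) ^+ n + M) => p.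
  rewrite -[dyadic_step _ _ _](subKr (f p)) (le_trans (ler_normB _ _))//.
  by rewrite addrC lerD// dyadic_step_close.
have SE n : simple_integral (fun A => S \1_A) (dyadic_step f n) =
            S (dyadic_step f n).
  have [s fs fE] := finite_range_decomp (finite_range_dyadic_step n bf).
  rewrite (simple_integralE _ (s := s)); last 2 first.
  - by rewrite indic0 bounded_functional0.
  - by rewrite fs.
  have mi r : G (dyadic_step f n @^-1` [set r]).
    exact: (measurable_wrt_dyadic_step n sG mf).
  rewrite [in RHS]fE bounded_functional_sum; last first.
    move=> r; apply: bounded_measurableM => //; first exact: bounded_measurable_cst.
    exact: bounded_measurable_indic.
  apply: eq_bigr => r _; rewrite bounded_functionalZ//.
  exact: bounded_measurable_indic.
apply/cvg_lim => //.
under eq_fun do rewrite SE.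
case: hS => _ [C hC].
have e0 : (2^-1 : R) ^+ n @[n --> \oo] --> 0.
  by apply: cvg_expr; rewrite ger0_norm ?invr_ge0// invf_lt1// ltr1n.
have /cvgrPdist_le hC0 : C * (2^-1) ^+ n @[n --> \oo] --> 0.
  by rewrite -(mulr0 C); exact: cvgMr.
apply/cvgrPdist_le => e /hC0; apply: filterS => n; rewrite sub0r normrN => hn.
have -> : S f - S (dyadic_step f n) = S (fun p => f p + (-1) * dyadic_step f n p).
  rewrite bounded_functionalD//; last first.
    by apply: bounded_measurableM => //; exact: bounded_measurable_cst.
  by rewrite bounded_functionalZ// mulN1r.
rewrite (le_trans (hC _ _ _ _) (le_trans (ler_norm _) hn))//.
  apply: bounded_measurableD => //; apply: bounded_measurableM => //.
  exact: bounded_measurable_cst.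
by move=> p; rewrite mulN1r dyadic_step_close.
Qed.

End bounded_functional_theory.

End finitely_additive.

Section fa_integral_indic.
Context {R : realType} {T : Type}.

(** The dyadic approximations leave an indicator unchanged. *)
Lemma fa_integral_indic (x : set T -> R) (A : set T) : x set0 = 0 ->
  fa_integral x \1_A = x A.
Proof.
move=> x0; have dE n : dyadic_step (\1_A : T -> R) n = \1_A.
  apply/funext => p; rewrite /dyadic_step indicE.
  have e0 : (2 ^+ n : R) != 0 by rewrite expf_neq0.
  case: (p \in A); last by rewrite mulr0 floor0 mul0r.
  have -> : (2 ^+ n * 1%:R : R) = (2 ^+ n)%:~R by rewrite mulr1 rmorphXn.
  by rewrite intrKfloor rmorphXn/= divff.
rewrite /fa_integral; under eq_fun do rewrite dE.
rewrite lim_cst// (simple_integralE (s := [fset 0; 1]%fset))//; last first.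
  move=> _ [p _ <-]; rewrite indicE /= !inE.
  by case: (_ \in _); rewrite ?eqxx ?orbT.
rewrite big_fsetU1/= ?inE 1?eq_sym ?oner_eq0// big_seq_fset1 mul0r add0r mul1r.
congr x; apply/seteqP; split => p /=; rewrite indicE.
  by have [|_ /eqP] := boolP (p \in A); [rewrite inE|rewrite eq_sym oner_eq0].
by move=> Ap; rewrite mem_set.
Qed.

End fa_integral_indic.

(** * Conditional expectations given a sub-sigma-algebra *)

Section radon_nikodym_sub_sigma_algebra.
Context {dO : measure_display} {Omega : measurableType dO} {R : realType}.
Variables (P : probability Omega R) (G : set (set Omega)).
Hypotheses (sG : sigma_algebra setT G) (Gm : G `<=` measurable).

(** The Radon-Nikodym theorem is applied on [Omega] equipped with [G] and with the
    image of [P] under the identity, so that the density is [G]-measurable. *)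
Lemma density_sub_sigma_algebra (lam : set Omega -> R) :
  countably_additive_on G lam -> (forall N, G N -> P N = 0%E -> lam N = 0) ->
  exists Z, [/\ measurable_wrt G Z, integrable_rv P Z &
    forall A, G A -> \int[P]_(w in A) Z w = lam A].
Proof.
move=> lamD lam0.
pose S := g_sigma_algebraType G.
have GE : @measurable _ S = G by exact: measurable_g_measurableTypeE.
pose nu0 (A : set S) := (lam A)%:E.
have nu00 : nu0 set0 = 0%E by rewrite /nu0 lam0//; case: sG.
have nuf A : measurable A -> nu0 A \is a fin_num by [].
have nusa : semi_sigma_additive nu0.
  move=> B mB tB mUB; rewrite /nu0; under eq_fun do rewrite sumEFin.
  apply/cvg_EFin; first exact: nearW.
  by apply: lamD => // [n|]; rewrite -GE.
pose nu : {charge set S -> \bar R} := HB.pack nu0 (isCharge.Build _ S R nu0 nu00 nuf nusa).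
have mid : measurable_fun setT (idfun : Omega -> S).
  by move=> _ B; rewrite GE setTI; exact: Gm.
pose idS : {mfun Omega >-> S} := HB.pack (idfun : Omega -> S)
   (isMeasurableFun.Build _ _ _ _ (idfun : Omega -> S) mid).
pose mu : probability S R := distribution P idS.
have numu : nu `<< mu.
  by apply/null_content_dominatesP => A; rewrite GE => GA A0; rewrite /= /nu0 lam0.
pose g := Radon_Nikodym nu mu.
have gfin x : g x \is a fin_num by exact: Radon_Nikodym_fin_num.
have gi := Radon_Nikodym_integrable numu.
have mg : measurable_fun setT g by exact: measurable_int gi.
have giP : P.-integrable setT (g \o idS).
  apply/integrableP; split; first exact: measurableT_comp.
  move/integrableP : (gi) => [_]; rewrite ge0_integral_distribution//.
  exact: measurableT_comp.
have EZ : EFin \o (fine \o g) = g \o idS.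
  by apply/funext => w; rewrite /= fineK.
exists (fine \o g); split.
- move=> B mB; rewrite -GE -[X in measurable X]setTI.
  by apply: measurableT_comp mg _ _ _ => //; exact: fine_measurable.
- by rewrite /integrable_rv EZ.
- move=> A GA; rewrite /Rintegral -[RHS]/(fine (nu A)).
  rewrite (Radon_Nikodym_integral numu) ?GE//; congr fine.
  rewrite [RHS](@integral_pushforward _ _ _ _ _ idS)//; last by rewrite GE.
    by apply: eq_integral => w _; rewrite -[LHS]/((EFin \o (fine \o g)) w) EZ.
  apply: integrableS giP => //; exact: Gm.
Qed.

End radon_nikodym_sub_sigma_algebra.

Section real_integrals.
Context {dO : measure_display} {Omega : measurableType dO} {R : realType}.
Variable P : probability Omega R.
Implicit Types (Y Z U h : Omega -> R) (A : set Omega).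

Lemma integrable_rvD Y Z : integrable_rv P Y -> integrable_rv P Z ->
  integrable_rv P (fun w => Y w + Z w).
Proof. by move=> iY iZ; exact: (integrableD measurableT iY iZ). Qed.

Lemma integrable_rvZ a Y : integrable_rv P Y -> integrable_rv P (fun w => a * Y w).
Proof. by move=> iY; exact: (integrableZl measurableT a iY). Qed.

Lemma integrable_rvB Y Z : integrable_rv P Y -> integrable_rv P Z ->
  integrable_rv P (fun w => Y w - Z w).
Proof. by move=> iY iZ; exact: (integrableB measurableT iY iZ). Qed.

Lemma bounded_measurable_fun h : bounded_measurable measurable h ->
  measurable_fun setT h.
Proof. by move=> [mh _] _ B mB; rewrite setTI; exact: mh. Qed.

Lemma integrable_rvM h Y : bounded_measurable measurable h ->
  integrable_rv P Y -> integrable_rv P (fun w => h w * Y w).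
Proof.
move=> bmh iY; have [_ bh] := bmh.
by have := integrableMr measurableT (bounded_measurable_fun bmh) bh iY.
Qed.

Lemma integrable_rv_bounded h : bounded_measurable measurable h ->
  integrable_rv P h.
Proof.
move=> bmh; have [_ bh] := bmh.
apply: measurable_bounded_integrable => //; last exact: bounded_measurable_fun.
by rewrite [ltLHS]probability_setT ltry.
Qed.

Lemma integrable_rv_cst (r : R) : integrable_rv P (fun=> r).
Proof. exact: finite_measure_integrable_cst. Qed.

Lemma bounded_measurable_sub (G : set (set Omega)) h : G `<=` measurable ->
  bounded_measurable G h -> bounded_measurable measurable h.
Proof. by move=> Gm [mh bh]; split=> // B mB; apply/Gm/mh. Qed.

Lemma sigma_algebra_measurable : sigma_algebra setT (@measurable _ Omega).
Proof.
split=> // [A mA|F mF]; first exact: measurableD.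
exact: bigcupT_measurable.
Qed.

Lemma Rintegral_indic A Y :
  \int[P]_(w in A) Y w = \int[P]_w (\1_A w * Y w).
Proof.
rewrite Rintegral_mkcond; apply: eq_Rintegral => w _.
by rewrite indicE patchE; case: ifP => _; rewrite ?mul1r ?mul0r.
Qed.

Lemma integrable_rv_sum (I : Type) (s : seq I) (Y : I -> Omega -> R) :
  (forall i, integrable_rv P (Y i)) ->
  integrable_rv P (fun w => \sum_(i <- s) Y i w).
Proof.
move=> iY; elim: s => [|i s ih].
  under [X in integrable_rv _ X]eq_fun do rewrite big_nil.
  exact: integrable_rv_cst.
under [X in integrable_rv _ X]eq_fun do rewrite big_cons.
exact: integrable_rvD.
Qed.

Lemma Rintegral_sum (I : Type) (s : seq I) (Y : I -> Omega -> R) :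
  (forall i, integrable_rv P (Y i)) ->
  \int[P]_w (\sum_(i <- s) Y i w) = \sum_(i <- s) \int[P]_w Y i w.
Proof.
move=> iY; elim: s => [|i s ih].
  under eq_Rintegral do rewrite big_nil.
  by rewrite big_nil Rintegral_cst// mul0r.
under eq_Rintegral do rewrite big_cons.
rewrite big_cons RintegralD ?ih//; [exact: iY|exact: integrable_rv_sum].
Qed.

Lemma Rintegral_dominated (f_ : nat -> Omega -> R) f g :
  (forall n, integrable_rv P (f_ n)) -> integrable_rv P f ->
  integrable_rv P g -> (forall w, f_ n w @[n --> \oo] --> f w) ->
  (forall n w, `|f_ n w| <= g w) ->
  \int[P]_w f_ n w @[n --> \oo] --> \int[P]_w f w.
Proof.
move=> if_ iF ig ff fg.
have [] := @dominated_convergence _ _ _ P setT measurableT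
  (fun n => EFin \o f_ n) (EFin \o f) (EFin \o g).
- by move=> n; exact: measurable_int (if_ n).
- exact: measurable_int iF.
- by apply: aeW => w _; apply/cvg_EFin; [exact: nearW|exact: ff].
- exact: ig.
- by apply: aeW => w n _; rewrite /= lee_fin.
move=> _ _ h; apply: fine_cvg.
by rewrite fineK//; exact: integrable_fin_num iF.
Qed.

Lemma countably_additive_Rintegral U : integrable_rv P U ->
  countably_additive_on measurable (fun A => \int[P]_(w in A) U w).
Proof.
move=> iU F mF tF mUF.
have : (\sum_(0 <= i < n) induced_charge iU (F i))%E @[n --> \oo] -->
    induced_charge iU (\bigcup_n F n) by exact: charge_semi_sigma_additive.
have E A : measurable A ->
    induced_charge iU A = (\int[P]_(w in A) U w)%:E.
  move=> mA; rewrite /Rintegral fineK//; apply: integrable_fin_num => //.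
  exact: integrableS iU.
rewrite E//; under eq_fun do under eq_bigr do rewrite E//.
under eq_fun do rewrite sumEFin.
by move/fine_cvg.
Qed.

End real_integrals.

Section conditional_expectation.
Context {dO : measure_display} {Omega : measurableType dO} {R : realType}.
Variables (P : probability Omega R) (G : set (set Omega)).
Hypotheses (sG : sigma_algebra setT G) (Gm : G `<=` measurable).
Implicit Types (Y Z U h : Omega -> R) (A : set Omega).

(** The functional [h |-> \int h U] is the integral against [A |-> \int_A U], a set
    function that vanishes on [G]. *)
Lemma Rintegral_mul_eq0_bounded U h : integrable_rv P U ->
  (forall A, G A -> \int[P]_(w in A) U w = 0) -> bounded_measurable G h ->
  \int[P]_w (h w * U w) = 0.
Proof.
move=> iU U0 bmh.
have iM f : bounded_measurable G f -> integrable_rv P (fun w => f w * U w).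
  by move=> /(bounded_measurable_sub Gm) bf; exact: integrable_rvM.
have bF : bounded_functional G (fun f => \int[P]_w (f w * U w)).
  split=> [a f g bf bg|].
    under eq_Rintegral do rewrite mulrDl -mulrA.
    rewrite RintegralD ?RintegralZl//; [exact: iM|exact: integrable_rvZ (iM _ _)|exact: iM].
  exists (\int[P]_w `|U w|) => f M bf fM.
  rewrite (le_trans (le_normr_Rintegral _ _))//; first exact: iM.
  rewrite mulrC -RintegralZl//; last exact: integrable_norm.
  apply: le_Rintegral => //.
  - exact/integrable_norm/iM.
  - exact/integrable_rvZ/integrable_norm.
  - by move=> w _; rewrite normrM ler_wpM2r.
rewrite -(fa_integral_functional sG bF bmh).
rewrite (@fa_integral_agree _ _ _ sG _ (fun=> 0))//.
  rewrite /fa_integral /simple_integral.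
  under eq_fun do under eq_fsbigr do rewrite mulr0.
  under eq_fun do rewrite fsbig1//.
  exact: lim_cst.
by move=> A GA; rewrite -Rintegral_indic U0.
Qed.

(** Unbounded [h] are reached by truncation and dominated convergence. This is
    needed for [cond_exp_adjoint], where [U] is bounded but [h] need not be. *)
Lemma Rintegral_mul_eq0 U h : integrable_rv P U ->
  (forall A, G A -> \int[P]_(w in A) U w = 0) -> measurable_wrt G h ->
  integrable_rv P (fun w => h w * U w) -> \int[P]_w (h w * U w) = 0.
Proof.
move=> iU U0 mh ihU.
pose A n := [set w | `|h w| <= n%:R].
have GA n : G (A n).
  have := measurable_wrt_comp sG (@normr_measurable R setT) mh.
  by move=> /(_ _ (measurable_itv `]-oo, n%:R])); rewrite set_itvE.
pose h_ n w := h w * \1_(A n) w.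
have bh n : bounded_measurable G (h_ n).
  split; first by apply: measurable_wrtM => //; exact: measurable_wrt_indic.
  apply/boundedP; exists n%:R => w; rewrite /h_ indicE.
  have [wA|] := boolP (w \in A n); rewrite ?mulr1 ?mulr0 ?normr0//.
  by rewrite inE in wA.
have lim1 : \int[P]_w (h_ n w * U w) @[n --> \oo] --> \int[P]_w (h w * U w).
  apply: (@Rintegral_dominated _ _ _ _ _ _ (fun w => `|h w * U w|)) => //.
  - by move=> n; apply: integrable_rvM => //; exact: bounded_measurable_sub (bh n).
  - exact: integrable_norm.
  - move=> w; apply: (@cvg_near_cst _ _ _ _ _).
    near=> n; rewrite /h_ indicE mem_set ?mulr1//=.
    by near: n; exact: nbhs_infty_ger.
  - move=> n w; rewrite /h_ indicE !normrM ler_wpM2r//.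
    by rewrite ler_piMr// ger0_norm// lern1; case: (_ \in _).
rewrite -(cvg_lim _ lim1)//.
under eq_fun do rewrite Rintegral_mul_eq0_bounded//.
exact: lim_cst.
Unshelve. all: by end_near.
Qed.

Lemma is_cond_expN Y Z : integrable_rv P Y -> is_cond_exp P G Y Z ->
  is_cond_exp P G (fun w => - Y w) (fun w => - Z w).
Proof.
move=> iY [mZ iZ YZ]; split.
- exact: (measurable_wrt_comp sG (@oppr_measurable R setT) mZ).
- by have := integrable_rvZ (-1) iZ; under eq_fun do rewrite mulN1r.
- move=> A GA; have mA := Gm GA.
  under eq_Rintegral do rewrite -mulN1r.
  under [RHS]eq_Rintegral do rewrite -mulN1r.
  by rewrite !RintegralZl// ?YZ//; apply: integrableS (measurableT) _ _ _.
Qed.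

(** The excess of [Z] over the bound [M] is nonnegative, and its integral over a
    set of [G] is that of [Y - M] over a smaller set of [G], hence nonpositive. *)
Lemma is_cond_exp_clip_above Y Z M : integrable_rv P Y -> is_cond_exp P G Y Z ->
  (forall w, Y w <= M) -> is_cond_exp P G Y (fun w => Num.min (Z w) M).
Proof.
move=> iY [mZ iZ YZ] YM.
pose B := [set w | M < Z w].
have GB : G B by have := mZ _ (measurable_itv `]M, +oo[); rewrite set_itvE.
pose U w := \1_B w * (Z w - M).
have bB : bounded_measurable measurable (\1_B : Omega -> R).
  apply: bounded_measurable_indic; last exact: Gm.
  exact: sigma_algebra_measurable.
have iU : integrable_rv P U.
  by apply: integrable_rvM => //; apply: integrable_rvB iZ (integrable_rv_cst _ _).
have minE w : Num.min (Z w) M = Z w - U w.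
  rewrite /U indicE /B minElt; case: ltP => ZM.
    by rewrite memNset ?mul0r ?subr0//=; apply/negP; rewrite -leNgt ltW.
  have [<-|MZ] := eqVneq M (Z w); first by rewrite subrr mulr0 subr0.
  by rewrite mem_set ?mul1r ?subKr//= lt_neqAle MZ.
under [X in is_cond_exp _ _ _ X]eq_fun do rewrite minE.
split.
- apply: measurable_wrtB => //; apply: measurable_wrtM => //.
    exact: measurable_wrt_indic.
  by apply: measurable_wrtB => //; exact: measurable_wrt_cst.
- exact: integrable_rvB.
- move=> A GA; have mA := Gm GA; have mB := Gm GB.
  have iA f : integrable_rv P f -> P.-integrable A (EFin \o f).
    by move=> ?; apply: integrableS (measurableT) _ _ _.
  rewrite RintegralB ?YZ//; [|exact: iA..].
  suff -> : \int[P]_(w in A) U w = 0 by rewrite subr0.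
  apply/eqP; rewrite eq_le; apply/andP; split; last first.
    apply: Rintegral_ge0 => w _; rewrite /U indicE /B.
    have [|] := boolP (w \in _); last by rewrite mul0r.
    by rewrite inE/= mul1r subr_ge0 => /ltW.
  have GAB : G (A `&` B) by exact: sigma_setI.
  have iAB f : integrable_rv P f -> P.-integrable (A `&` B) (EFin \o f).
    by move=> ?; apply: integrableS (measurableT) _ _ _ => //; exact: Gm.
  have -> : \int[P]_(w in A) U w = \int[P]_(w in A `&` B) (Z w - M).
    rewrite Rintegral_indic [RHS]Rintegral_indic; apply: eq_Rintegral => w _.
    by rewrite /U mulrA indicI.
  rewrite RintegralB//; [|exact: Gm|exact: iAB|exact/iAB/integrable_rv_cst].
  rewrite YZ// subr_le0; apply: le_Rintegral => //; first exact: Gm.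
    exact: iAB.
  exact/iAB/integrable_rv_cst.
Qed.

(** A density of [A |-> \int_A Y] on [G] need not obey the bounds of [Y]; clipping
    it at the best bound [M] on both sides repairs this without changing its
    integrals. *)
Lemma cond_exp_spec Y : integrable_rv P Y ->
  is_cond_exp P G Y (cond_exp P G Y) /\
  forall M : R, (forall w, `|Y w| <= M) -> forall w, `|cond_exp P G Y w| <= M.
Proof.
move=> iY; apply: (@xgetPex _ _ [set Z | is_cond_exp P G Y Z /\
    forall M : R, (forall w, `|Y w| <= M) -> forall w, `|Z w| <= M]).
have [Z [mZ iZ YZ]] : exists Z, is_cond_exp P G Y Z.
  case: (@density_sub_sigma_algebra _ _ _ P G sG Gm
    (fun A => \int[P]_(w in A) Y w)) => [||Z [mZ iZ YZ]]; last by exists Z.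
  - move=> F GF tF GUF; apply: countably_additive_Rintegral => //; last exact: Gm.
    by move=> n; exact: Gm.
  - move=> N GN N0; rewrite /Rintegral null_set_integral//; first exact: Gm.
    exact/measurable_funTS/(measurable_int _ iY).
have [[M0 YM0]|nbY] := pselect (exists M, forall w, `|Y w| <= M); last first.
  by exists Z; split => // M YM; case: nbY; exists M.
pose M := sup (range (fun w => `|Y w|)).
have YM w : `|Y w| <= M.
  apply: ub_le_sup; last by exists w.
  by exists M0 => _ [w' _ <-].
have MM N : (forall w, `|Y w| <= N) -> M <= N.
  by move=> YN; apply: ge_sup => [|_ [w _ <-]//]; exists `|Y point|, point.
have M_ge0 : 0 <= M := le_trans (normr_ge0 _) (YM point).
have YM1 w : Y w <= M by rewrite (le_trans (ler_norm _)).
have YM2 w : - Y w <= M by rewrite (le_trans (ler_norm _))// normrN.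
have h1 := is_cond_exp_clip_above iY (And3 mZ iZ YZ) YM1.
have iY' : integrable_rv P (fun w => - Y w).
  by have := integrable_rvZ (-1) iY; under eq_fun do rewrite mulN1r.
have h2 := is_cond_exp_clip_above iY' (is_cond_expN iY h1) YM2.
have := is_cond_expN iY' h2; under eq_fun do rewrite opprK.
set Z' := (X in is_cond_exp _ _ _ X) => h3; exists Z'; split => // N YN w.
apply: le_trans (MM _ YN); rewrite /Z' normrN ler_norml.
rewrite ge_min lexx orbT andbT le_min lerN2 ge_min lexx orbT/=.
by rewrite (le_trans _ M_ge0)// oppr_le0.
Qed.

Lemma cond_expP Y : integrable_rv P Y -> is_cond_exp P G Y (cond_exp P G Y).
Proof. by move=> /cond_exp_spec[]. Qed.

Lemma bounded_measurable_cond_exp Y : bounded_measurable measurable Y ->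
  bounded_measurable G (cond_exp P G Y).
Proof.
move=> bmY; have [[mZ _ _] bZ] := cond_exp_spec (integrable_rv_bounded P bmY).
split=> //; case: bmY => _ /boundedP[M YM]; apply/boundedP; exists M; exact: bZ.
Qed.

Lemma cond_exp_pull_out Y Z h : integrable_rv P Y -> is_cond_exp P G Y Z ->
  bounded_measurable G h -> \int[P]_w (h w * Y w) = \int[P]_w (h w * Z w).
Proof.
move=> iY [mZ iZ YZ] bh; have bh' := bounded_measurable_sub Gm bh.
apply/eqP; rewrite -subr_eq0 -RintegralB//; [|exact: integrable_rvM..].
under eq_Rintegral do rewrite -mulrBr.
apply/eqP/Rintegral_mul_eq0_bounded => //; first exact: integrable_rvB.
move=> A GA; have mA := Gm GA; rewrite RintegralB//.
- by rewrite YZ// subrr.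
- by apply: integrableS (measurableT) _ _ _.
- by apply: integrableS (measurableT) _ _ _.
Qed.

(** The difference between [f] and its conditional expectation is orthogonal to all
    [G]-measurable [W], even unbounded ones, because it is bounded itself. *)
Lemma cond_exp_adjoint f W : bounded_measurable measurable f ->
  measurable_wrt G W -> integrable_rv P W ->
  \int[P]_w (cond_exp P G f w * W w) = \int[P]_w (f w * W w).
Proof.
move=> bf mW iW; have if_ := integrable_rv_bounded P bf.
have bc := bounded_measurable_sub Gm (bounded_measurable_cond_exp bf).
have [mc ic fc] := cond_expP if_.
apply/eqP; rewrite -subr_eq0 -RintegralB//; [|exact: integrable_rvM..].
under eq_Rintegral do rewrite -mulrBl mulrC.
apply/eqP/Rintegral_mul_eq0 => //; first exact: integrable_rvB.
- move=> A GA; have mA := Gm GA; rewrite RintegralB//.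
  + by rewrite fc// subrr.
  + by apply: integrableS (measurableT) _ _ _.
  + by apply: integrableS (measurableT) _ _ _.
- under [X in integrable_rv _ X]eq_fun do rewrite mulrC mulrBl.
  by apply: integrable_rvB; exact: integrable_rvM.
Qed.

End conditional_expectation.

(** * Consecutive points of finite sets, and Banach limits *)

Section steps_theory.
Context {dD : Order.disp_t} {Delta : orderType dD}.
Implicit Types (d : {fset Delta}) (s t u : Delta).

Lemma consecutive_path (x : Delta) (l : seq Delta) a b :
  path <%O x l -> (a, b) \in zip (x :: l) l ->
  [/\ a \in x :: l, b \in l, (a < b)%O &
      forall c, c \in x :: l -> (c <= a)%O || (b <= c)%O].
Proof.
elim: l x => [//|y l ih] x /andP[xy yl].
have yle c : c \in y :: l -> (y <= c)%O.
  rewrite inE => /predU1P[->//|cl]; apply/ltW.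
  by have /allP := order_path_min lt_trans yl; exact.
rewrite [zip _ _]/= inE => /predU1P[[-> ->]|/(ih _ yl)[al bl ab abc]].
  split=> //; rewrite ?inE ?eqxx// => c; rewrite inE => /predU1P[->|].
    by rewrite lexx.
  by move=> /yle ->; rewrite orbT.
split=> //; rewrite 1?inE ?al ?bl ?orbT// => c.
rewrite inE => /predU1P[->|]; last exact: abc.
by rewrite (le_trans (ltW xy) (yle _ al)).
Qed.

Lemma le_path_last (x : Delta) (l : seq Delta) t :
  path <%O x l -> t \in x :: l -> (t <= last x l)%O.
Proof.
elim: l x t => [x t _|y l ih x t /andP[xy yl]]; first by rewrite inE => /eqP ->.
rewrite inE => /predU1P[->|]; last exact: ih.
by rewrite (le_trans (ltW xy))// ih// mem_head.
Qed.

Lemma steps_consecutive d s t : (s, t) \in steps d ->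
  [/\ s \in d, t \in d, (s < t)%O &
      forall u, u \in d -> (u <= s)%O || (t <= u)%O].
Proof.
rewrite /steps; have memE u : (u \in sort <=%O (enum_fset d)) = (u \in d).
  by rewrite mem_sort.
have : sorted <%O (sort <=%O (enum_fset d)).
  by rewrite sort_lt_sorted fset_uniq.
case: (sort _ _) memE => [//|x l] memE /= xl /(consecutive_path xl).
move=> [sl tl st h]; split => //; rewrite -?memE// ?inE ?tl ?orbT// => u.
by rewrite -memE; exact: h.
Qed.

Lemma steps_uniq d : uniq (steps d).
Proof.
apply: (@map_uniq _ _ snd); rewrite /steps -/(unzip2 _).
have : uniq (sort <=%O (enum_fset d)) by rewrite sort_uniq fset_uniq.
by case: (sort _ _) => [//|x l] /= /andP[_ ul]; rewrite unzip2_zip.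
Qed.

(** The intervals []s, t]] of two steps that share a point coincide, since no point
    of [d] lies strictly inside a step. *)
Lemma steps_disjoint d s t s' t' u : (s, t) \in steps d ->
  (s', t') \in steps d -> (s < u <= t)%O -> (s' < u <= t')%O ->
  (s, t) = (s', t').
Proof.
move=> /steps_consecutive[sd td st h] /steps_consecutive[s'd t'd st' h'].
move=> /andP[su ut] /andP[su' ut'].
have tt' : t = t'.
  apply/eqP; rewrite eq_le; apply/andP; split.
    have /orP[|//] := h _ t'd; rewrite leNgt => /negP[].
    exact: lt_le_trans su ut'.
  have /orP[|//] := h' _ td; rewrite leNgt => /negP[].
  exact: lt_le_trans su' ut.
congr (_, _) => //; apply/eqP; rewrite eq_le; apply/andP; split.
  have /orP[//|] := h' _ sd; rewrite leNgt => /negP[].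
  exact: lt_le_trans su ut'.
have /orP[//|] := h _ s'd; rewrite leNgt => /negP[].
exact: lt_le_trans su' ut.
Qed.

Section sums.
Context {R : realType}.

Lemma sum_steps_indic d (phi : Delta * Delta -> R) s t u : (s, t) \in steps d ->
  (s < u <= t)%O ->
  \sum_(st <- steps d) phi st * \1_(`]st.1, st.2]%classic : set Delta) u =
  phi (s, t).
Proof.
move=> std su; rewrite (bigD1_seq (s, t)) ?steps_uniq//= indicE mem_set/= ?in_itv//.
rewrite mulr1 big_seq_cond big1 ?addr0// => -[s' t'] /andP[std' /eqP ne].
rewrite indicE memNset ?mulr0//= in_itv/= => su'; apply: ne.
exact: steps_disjoint std' std su' su.
Qed.

Lemma sum_steps_indic0 d (phi : Delta * Delta -> R) u :
  (forall s t, (s, t) \in steps d -> ~~ (s < u <= t)%O) ->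
  \sum_(st <- steps d) phi st * \1_(`]st.1, st.2]%classic : set Delta) u = 0.
Proof.
move=> h; rewrite big_seq big1// => -[s t] std; rewrite indicE memNset ?mulr0//=.
by rewrite in_itv/=; apply/negP/h.
Qed.

Lemma sum_zip_telescope (phi : Delta -> R) (x : Delta) (l : seq Delta) :
  \sum_(st <- zip (x :: l) l) (phi st.2 - phi st.1) = phi (last x l) - phi x.
Proof.
elim: l x => [|y l ih] x; first by rewrite big_nil subrr.
by rewrite [zip _ _]/= big_cons ih /= addrC subrKA.
Qed.

(** The selected terms are the increments of [phi] along the points clipped to lie
    between [s] and [t], and for these increments the whole sum telescopes. *)
Lemma sum_steps_telescope d (phi : Delta -> R) s t : s \in d -> t \in d ->
  (s <= t)%O ->
  \sum_(st <- steps d) \1_(`]s, t]%classic : set Delta) st.2 *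
     (phi st.2 - phi st.1) = phi t - phi s.
Proof.
move=> sd td st; pose clip u := phi (Order.min t (Order.max s u)).
transitivity (\sum_(ab <- steps d) (clip ab.2 - clip ab.1)).
  apply: eq_big_seq => -[a b] /steps_consecutive[ad bd ab h] /=.
  rewrite indicE /clip; have [bs|sb] := leP b s.
    rewrite memNset ?mul0r/=; last by rewrite in_itv/= ltNge bs.
    rewrite (max_l (le_trans (ltW ab) bs)) ?subrr//.
  have [bt|tb] := leP b t.
    rewrite mem_set/= ?in_itv/= ?sb// mul1r.
    have sa : (s <= a)%O by have := h _ sd; rewrite [(b <= s)%O]leNgt sb orbF.
    by rewrite (max_r sa) (min_r (le_trans (ltW ab) bt)).
  rewrite memNset ?mul0r/=; last by rewrite in_itv/= [(b <= t)%O]leNgt tb andbF.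
  have ta : (t <= a)%O by have := h _ td; rewrite [(b <= t)%O]leNgt tb orbF.
  by rewrite (max_r (le_trans st ta)) (min_l ta) subrr.
rewrite /steps; have memE u : (u \in sort <=%O (enum_fset d)) = (u \in d).
  by rewrite mem_sort.
have : sorted <%O (sort <=%O (enum_fset d)).
  by rewrite sort_lt_sorted fset_uniq.
case: (sort _ _) memE => [memE _|x l memE].
  by have := memE s; rewrite sd.
move=> /= xl; rewrite sum_zip_telescope /clip.
have xs : (x <= s)%O.
  move: sd; rewrite -memE inE => /predU1P[->//|sl]; apply/ltW.
  by have /allP := order_path_min lt_trans xl; exact.
have tl : (t <= last x l)%O.
  by apply: le_path_last xl _; rewrite memE.
by rewrite (max_l xs) (min_r st) (max_r (le_trans st tl)) (min_l tl).
Qed.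

End sums.
End steps_theory.

Section banach_limit_theory.
Context {R : realType} {dD : Order.disp_t} {Delta : orderType dD}.
Variable L : ({fset Delta} -> R) -> R.
Hypothesis hL : banach_limit L.
Implicit Types (u v : {fset Delta} -> R) (d : {fset Delta}).

(** Every limit of a net that is computed explicitly is of this kind. *)
Lemma banach_limit_eventually u (l : R) d0 : [bounded u d | d in setT] ->
  (forall d, fsubset d0 d -> u d = l) -> L u = l.
Proof.
move=> bu ul; case: hL => _ _; apply => // A Al.
by exists d0 => //= d dd; rewrite /= ul//; exact: nbhs_singleton.
Qed.

Lemma banach_limit_cst (l : R) : L (fun=> l) = l.
Proof.
apply: (@banach_limit_eventually _ _ fset0) => //.
by apply/boundedP; exists `|l|.
Qed.

Lemma banach_limitN u : [bounded u d | d in setT] -> L (fun d => - u d) = - L u.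
Proof.
move=> bu; have b0 : [bounded (fun=> 0 : R) d | d in [set: {fset Delta}]].
  by apply/boundedP; exists 0 => d; rewrite normr0.
case: (hL) => lin _ _; rewrite -mulN1r -[RHS]addr0 -[in RHS](banach_limit_cst 0).
by rewrite -lin//; congr L; apply/funext => d; rewrite mulN1r addr0.
Qed.

Lemma banach_limit_le u (M : R) : (forall d, `|u d| <= M) -> `|L u| <= M.
Proof.
move=> uM; have bu : [bounded u d | d in setT] by apply/boundedP; exists M.
have bM (r : R) : [bounded (fun=> r) d | d in [set: {fset Delta}]].
  by apply/boundedP; exists `|r|.
case: (hL) => lin pos _; rewrite ler_norml.
have h1 : 0 <= L (fun d => (-1) * u d + M).
  apply: pos => [|d]; last first.
    by rewrite mulN1r addrC subr_ge0 (le_trans (ler_norm _)).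
  apply/boundedP; exists (M + `|M|) => d; rewrite mulN1r.
  by rewrite (le_trans (ler_normD _ _))// normrN lerD.
have h2 : 0 <= L (fun d => 1 * u d + M).
  apply: pos => [|d]; last first.
    by rewrite mul1r -lerBlDr sub0r; have := uM d; rewrite ler_norml => /andP[].
  apply/boundedP; exists (M + `|M|) => d; rewrite mul1r.
  by rewrite (le_trans (ler_normD _ _))// lerD.
rewrite lin// banach_limit_cst in h1; rewrite lin// banach_limit_cst in h2.
by apply/andP; split; lra.
Qed.

End banach_limit_theory.

(** * The pairing of a bounded function with a process *)

Section processes_theory.
Context {dO : measure_display} {Omega : measurableType dO} {R : realType}.
Context {dD : Order.disp_t} {Delta : orderType dD}.
Variables (P : probability Omega R) (F : Delta -> set (set Omega)).
Hypotheses (hP : measure_is_complete P) (hF : filtration P F).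
Implicit Types (X Y : Delta -> Omega -> R) (d : {fset Delta}).
Implicit Types (x y : set (Omega * Delta) -> R) (f : Omega * Delta -> R).
Implicit Types (s t : Delta).

Let sF t : sigma_algebra setT (F t). Proof. by case: hF. Qed.
Let Fm t : F t `<=` measurable. Proof. by case: hF. Qed.
Let Fle s t : (s <= t)%O -> F s `<=` F t. Proof. by case: hF => _ _ h _; exact: h. Qed.

Lemma sigma_algebra_barF : sigma_algebra setT (@barF _ Omega _ _ Delta P).
Proof. exact: smallest_sigma_algebra. Qed.
Let sB := sigma_algebra_barF.

Lemma barF_rect (H : set Omega) (D : set Delta) :
  measurable H -> barF P (H `*` D).
Proof. by move=> mH; apply: sub_sigma_algebra; left; exists H => //; exists D. Qed.

Lemma barF_evanescent : evanescent P `<=` @barF _ Omega _ _ Delta P.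
Proof. by move=> A eA; apply: sub_sigma_algebra; right. Qed.

(** This is where completeness of [P] enters: the sections of an evanescent set
    are only negligible. *)
Lemma barF_section (A : set (Omega * Delta)) t :
  barF P A -> measurable [set w | A (w, t)].
Proof.
move: A; apply: (@smallest_sub _ _ _ [set A | measurable [set w | A (w, t)]]).
  split => [|A mA|A mA] /=.
  - exact: measurable0.
  - rewrite (_ : [set _ | _] = ~` [set w | A (w, t)]); first exact: measurableC.
    by apply/seteqP; split => [w []//|w nA]; split.
  - rewrite (_ : [set _ | _] = \bigcup_n [set w | A n (w, t)]).
      exact: bigcupT_measurable.
    by apply/seteqP; split => w [n _ An]; exists n.
move=> A [[H mH [D _ <-]]|eA] /=.
  have [Dt|nDt] := pselect (D t).
    by rewrite (_ : [set _ | _] = H)//; apply/seteqP; split => w //= [].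
  rewrite (_ : [set _ | _] = set0); first exact: measurable0.
  by apply/seteqP; split => w //= [].
apply: hP; case: eA => N [mN N0 AN]; exists N; split => // w Aw.
by apply: AN; exists (w, t).
Qed.

Lemma bounded_measurable_section f t : bounded_measurable (barF P) f ->
  bounded_measurable measurable (fun w => f (w, t)).
Proof.
move=> [mf /boundedP[M fM]]; split; last by apply/boundedP; exists M.
by move=> B mB; exact: (barF_section t (mf B mB)).
Qed.

Lemma bounded_measurable_tensor (c : Omega -> R) (D : set Delta) :
  bounded_measurable measurable c ->
  bounded_measurable (barF P) (fun p : Omega * Delta => c p.1 * \1_D p.2).
Proof.
move=> [mc /boundedP[M cM]]; apply: bounded_measurableM => //.
  split; last by apply/boundedP; exists M => p; exact: cM.
  move=> B mB; rewrite (_ : _ @^-1` _ = (c @^-1` B) `*` setT).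
    by apply: barF_rect; exact: mc.
  by apply/seteqP; split => p //= [].
rewrite (_ : (fun p : Omega * Delta => \1_D p.2) = \1_(setT `*` D)).
  by apply: bounded_measurable_indic => //; exact: barF_rect.
by apply/funext => p; rewrite !indicE in_setX in_setT.
Qed.

(** Up to sign, the density with respect to [P] of the measure [H |-> x (H * ]s, t])] on
    [F s], where [x] is the measure associated with [X]. *)
Definition drift X s t (w : Omega) : R := cond_exp P (F s) (X t) w - X s w.

(** The quantity [P \int P^d(f) dX] whose Banach limit over [d] defines the measure of
    [X]. *)
Definition approx_pairing d f X : R :=
  \int[P]_w elementary_integral d (elementary_proj P F d f) X w.

Section drift_theory.
Variable X : Delta -> Omega -> R.
Hypothesis hX : L1_process P F X.

Lemma L1_integrable t : integrable_rv P (X t).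
Proof. by case: hX. Qed.
Let iX := L1_integrable.

Lemma measurable_drift s t : measurable_wrt (F s) (drift X s t).
Proof.
apply: measurable_wrtB => //; last by case: hX.
by case: (cond_expP (sF s) (@Fm s) (iX t)).
Qed.

Lemma integrable_drift s t : integrable_rv P (drift X s t).
Proof.
by apply: integrable_rvB => //; case: (cond_expP (sF s) (@Fm s) (iX t)).
Qed.

Lemma Rintegral_drift s t (c : Omega -> R) : bounded_measurable (F s) c ->
  \int[P]_w (c w * drift X s t w) =
  \int[P]_w (c w * X t w) - \int[P]_w (c w * X s w).
Proof.
move=> bc; have bc' := bounded_measurable_sub (@Fm s) bc.
have cX := cond_expP (sF s) (@Fm s) (iX t); have [_ icX _] := cX.
rewrite (cond_exp_pull_out (sF s) (@Fm s) (iX t) cX bc).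
rewrite -RintegralB//; [|exact: integrable_rvM..].
by apply: eq_Rintegral => w _; rewrite -mulrBr.
Qed.

Lemma elementary_projE d f s t w : (s, t) \in steps d ->
  elementary_proj P F d f (w, t) = cond_exp P (F s) (fun w => f (w, t)) w.
Proof.
move=> std; have [_ _ st _] := steps_consecutive std.
by rewrite /elementary_proj (sum_steps_indic
  (fun st => cond_exp P (F st.1) (fun w => f (w, st.2)) w) std)//= st lexx.
Qed.

Lemma bounded_measurable_elementary_proj d f : bounded_measurable (barF P) f ->
  bounded_measurable (barF P) (elementary_proj P F d f).
Proof.
move=> bf; apply: bounded_measurable_sum => // -[s t] /=.
apply: bounded_measurable_tensor; apply: bounded_measurable_sub (@Fm s) _.
by apply: bounded_measurable_cond_exp => //; exact: bounded_measurable_section.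
Qed.

Lemma approx_pairingE0 d f : bounded_measurable (barF P) f ->
  approx_pairing d f X = \sum_(st <- steps d)
    \int[P]_w (cond_exp P (F st.1) (fun w => f (w, st.2)) w * drift X st.1 st.2 w).
Proof.
move=> bf.
have bc s t : bounded_measurable (F s) (cond_exp P (F s) (fun w => f (w, t))).
  by apply: bounded_measurable_cond_exp => //; exact: bounded_measurable_section.
have bc' s t := bounded_measurable_sub (@Fm s) (bc s t).
under eq_bigr => st _ do rewrite Rintegral_drift// -RintegralB ?integrable_rvM//.
rewrite -Rintegral_sum; last first.
  by move=> st; apply: integrable_rvB; exact: integrable_rvM.
apply: eq_Rintegral => w _; apply: eq_big_seq => -[s t] std /=.
by rewrite (elementary_projE _ _ std) mulrBr.
Qed.

(** Conditional expectation is self-adjoint, so it can be moved from [f] to the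
    increments of [X]; in this form the linearity in [f] is evident. *)
Lemma approx_pairingE d f : bounded_measurable (barF P) f ->
  approx_pairing d f X = \sum_(st <- steps d)
    \int[P]_w (f (w, st.2) * drift X st.1 st.2 w).
Proof.
move=> bf; rewrite approx_pairingE0//; apply: eq_bigr => st _.
apply: cond_exp_adjoint => //; first exact: bounded_measurable_section.
- exact: measurable_drift.
- exact: integrable_drift.
Qed.

Lemma d_variationE d w :
  d_variation P F d X w = \sum_(st <- steps d) `|drift X st.1 st.2 w|.
Proof. by apply: eq_bigr => st _; rewrite distrC. Qed.

Lemma integrable_d_variation d : integrable_rv P (d_variation P F d X).
Proof.
rewrite (funext (d_variationE d)).
by apply: integrable_rv_sum => st; apply/integrable_norm/integrable_drift.
Qed.

Lemma Rintegral_d_variation d : \int[P]_w d_variation P F d X w =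
  \sum_(st <- steps d) \int[P]_w `|drift X st.1 st.2 w|.
Proof.
under eq_Rintegral do rewrite d_variationE.
by apply: Rintegral_sum => st; apply/integrable_norm/integrable_drift.
Qed.

Lemma approx_pairing_le d f M : bounded_measurable (barF P) f ->
  (forall p, `|f p| <= M) ->
  `|approx_pairing d f X| <= (\int[P]_w d_variation P F d X w) * M.
Proof.
move=> bf fM; rewrite approx_pairingE// Rintegral_d_variation mulr_suml.
rewrite (le_trans (ler_norm_sum _ _ _))//; apply: ler_sum => -[s t] _ /=.
have bft := bounded_measurable_section t bf.
have iD := integrable_drift s t.
rewrite (le_trans (le_normr_Rintegral _ _))//; first exact: integrable_rvM.
rewrite mulrC -RintegralZl//; last exact: integrable_norm.
apply: le_Rintegral => //.
- exact/integrable_norm/integrable_rvM.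
- exact/integrable_rvZ/integrable_norm.
- by move=> w _; rewrite normrM ler_wpM2r.
Qed.

(** For the steps of [d] inside []s, t]] the factor [c] is measurable at the left
    endpoint, so that the drifts can be replaced by increments, which telescope. *)
Lemma approx_pairing_tensor d s t (c : Omega -> R) : s \in d -> t \in d ->
  (s <= t)%O -> bounded_measurable (F s) c ->
  approx_pairing d (fun p => c p.1 * \1_(`]s, t]%classic : set Delta) p.2) X =
  \int[P]_w (c w * X t w) - \int[P]_w (c w * X s w).
Proof.
move=> sd td st bc; have bc' := bounded_measurable_sub (@Fm s) bc.
rewrite approx_pairingE; last exact: bounded_measurable_tensor.
rewrite -(sum_steps_telescope (fun u => \int[P]_w (c w * X u w)) sd td st).
apply: eq_big_seq => -[a b] /steps_consecutive[ad bd ab h] /=.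
rewrite indicE; have [|] := boolP (b \in _); last first.
  by under eq_Rintegral do rewrite mulr0 mul0r; rewrite Rintegral_cst// !mul0r.
rewrite inE/= in_itv/= => /andP[sb bt]; rewrite mul1r.
under eq_Rintegral do rewrite mulr1.
apply: Rintegral_drift; have sa : (s <= a)%O.
  by have := h _ sd; rewrite [(b <= s)%O]leNgt sb orbF.
by case: bc => mc ?; split => // B mB; apply: (Fle sa); exact: mc.
Qed.

End drift_theory.

End processes_theory.

(** * Strips and elementary sets *)

Section additive_set_functions.
Context {R : realType} {T : Type} (G : set (set T)).
Hypothesis sG : sigma_algebra setT G.
Variable x : set T -> R.
Hypothesis xU : forall A B, G A -> G B -> A `&` B = set0 ->
  x (A `|` B) = x A + x B.

Lemma additive_set0 : x set0 = 0.
Proof.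
have G0 : G set0 by case: sG.
by have := xU G0 G0 (setI0 _); rewrite setU0; lra.
Qed.

Lemma sigma_bigcup_seq (I : choiceType) (l : seq I) (B : I -> set T) :
  (forall i, i \in l -> G (B i)) -> G (\bigcup_(i in [set` l]) B i).
Proof.
elim: l => [|i l ih] GB.
  by rewrite bigcup0 => [|i]; case: sG.
rewrite bigcup_seq big_cons -bigcup_seq; apply: sigma_setU => //.
  by apply: GB; rewrite mem_head.
by apply: ih => j jl; apply: GB; rewrite inE jl orbT.
Qed.

Lemma additive_bigcup_seq (I : choiceType) (l : seq I) (B : I -> set T) : uniq l ->
  (forall i, i \in l -> G (B i)) ->
  (forall i j p, i \in l -> j \in l -> B i p -> B j p -> i = j) ->
  x (\bigcup_(i in [set` l]) B i) = \sum_(i <- l) x (B i).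
Proof.
elim: l => [|i l ih] /=.
  by move=> _ _ _; rewrite big_nil bigcup0 ?additive_set0// => i; rewrite /= in_nil.
move=> /andP[il ul] GB tB.
rewrite bigcup_seq !big_cons -bigcup_seq xU; last first.
- apply/seteqP; split => // p [Bip [j jl Bjp]]; move/negP: il; apply.
  by rewrite (tB _ _ _ _ _ Bip Bjp)// ?inE ?eqxx//= ?jl ?orbT//.
- by apply: sigma_bigcup_seq => j jl; apply: GB; rewrite inE jl orbT.
- by apply: GB; rewrite mem_head.
rewrite ih// => [j jl|j k p jl kl]; first by apply: GB; rewrite inE jl orbT.
by apply: tB; rewrite inE ?jl ?kl orbT.
Qed.

End additive_set_functions.

Section elementary_sets_theory.
Context {dO : measure_display} {Omega : measurableType dO} {R : realType}.
Context {dD : Order.disp_t} {Delta : orderType dD}.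
Variables (P : probability Omega R) (F : Delta -> set (set Omega)).
Hypotheses (hF : filtration P F).
Implicit Types (d : {fset Delta}) (s t : Delta).
Implicit Types (x y : set (Omega * Delta) -> R).

Let sF t : sigma_algebra setT (F t). Proof. by case: hF. Qed.
Let Fm t : F t `<=` measurable. Proof. by case: hF. Qed.

Definition strip (H : set Omega) s t : set (Omega * Delta) :=
  H `*` `]s, t]%classic.

Lemma strip_disjoint d (st st' : Delta * Delta) (H H' : set Omega) p :
  st \in steps d -> st' \in steps d ->
  strip H st.1 st.2 p -> strip H' st'.1 st'.2 p -> st = st'.
Proof.
case: st st' => [s t] [s' t'] std std' [_ /=]; rewrite in_itv/= => h.
by move=> [_ /=]; rewrite in_itv/= => h'; exact: steps_disjoint std std' h h'.
Qed.

Lemma steps_fst_inj d s t t' : (s, t) \in steps d -> (s, t') \in steps d -> t = t'.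
Proof.
move=> std std'; have [_ _ st _] := steps_consecutive std.
have [_ _ st' _] := steps_consecutive std'.
suff [] : (s, t) = (s, t') by [].
apply: (@steps_disjoint _ _ d _ _ _ _ (Order.min t t') std std').
  by rewrite lt_min st st' ge_min lexx.
by rewrite lt_min st st' ge_min lexx orbT.
Qed.

(** Elementary sets index their bases by left endpoints; indexing them by steps is
    the same, because a step is determined by its left endpoint. *)
Lemma elementary_sets_pairs d (K : Delta * Delta -> set Omega) :
  (forall st, st \in steps d -> F st.1 (K st)) ->
  elementary_sets F d (\bigcup_(st in [set` steps d]) strip (K st) st.1 st.2).
Proof.
move=> FK; exists (fun s => \bigcup_(t in [set t | (s, t) \in steps d]) K (s, t)).
  move=> s; have [[t std]|nst] := pselect (exists t, (s, t) \in steps d).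
    rewrite (_ : [set t | _] = [set t]) ?bigcup_set1; first exact: (FK (s, t)).
    by apply/seteqP; split => [u sud|_ -> //]; exact: steps_fst_inj sud std.
  by rewrite bigcup0 => [|t std]; [case: (sF s)|case: nst; exists t].
apply: eq_bigcupr => -[s t] std /=; congr (_ `*` _).
rewrite (_ : [set t | _] = [set t]) ?bigcup_set1//.
by apply/seteqP; split => [u sud|_ -> //]; exact: steps_fst_inj sud std.
Qed.

Lemma barF_strip (H : set Omega) s t : measurable H -> barF P (strip H s t).
Proof. exact: barF_rect. Qed.

Lemma elementary_sets_barF d : elementary_sets F d `<=` barF P.
Proof.
move=> _ [H FH ->]; apply: sigma_bigcup_seq; first exact: sigma_algebra_barF.
by move=> -[s t] _; apply: barF_strip; exact: Fm.
Qed.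

Lemma additive_elementary x d (K : Delta * Delta -> set Omega) : ba P x ->
  (forall st, st \in steps d -> measurable (K st)) ->
  x (\bigcup_(st in [set` steps d]) strip (K st) st.1 st.2) =
  \sum_(st <- steps d) x (strip (K st) st.1 st.2).
Proof.
move=> [xU _ _] mK; apply: (additive_bigcup_seq (G := barF P)) => //.
- exact: sigma_algebra_barF.
- exact: steps_uniq.
- by move=> st std; apply: barF_strip; exact: mK.
- by move=> st st' p std std' h h'; exact: strip_disjoint std std' h h'.
Qed.

(** The sections of an elementary set at the right endpoints of the steps
    determine it, as the step intervals contain their right endpoints. *)
Lemma elementary_section d A : elementary_sets F d A ->
  (forall s t, (s, t) \in steps d -> F s [set w | A (w, t)]) /\
  A = \bigcup_(st in [set` steps d]) strip [set w | A (w, st.2)] st.1 st.2.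
Proof.
move=> [H FH AE].
have AH s t : (s, t) \in steps d -> [set w | A (w, t)] = H s.
  move=> std; have [_ _ st _] := steps_consecutive std.
  have tst : `]s, t]%classic t by rewrite /= in_itv/= st lexx.
  apply/seteqP; split => [w|w Hw] /=; rewrite AE; last by exists (s, t).
  move=> [st' std' Hw].
  have ste := strip_disjoint std' std Hw (conj I tst : strip setT _ _ (w, t)).
  by case: Hw; rewrite ste.
split; first by move=> s t /AH ->.
by rewrite [LHS]AE; apply: eq_bigcupr => -[s t] std /=; rewrite /strip (AH _ _ std).
Qed.

(** The mass that a measure corresponding to [X] must give to a strip with
    [F s]-measurable base; it is the link between [x] and [X] through which
    all their properties are compared. *)
Definition represents_increments x (X : Delta -> Omega -> R) : Prop :=
  forall s t H, (s <= t)%O -> F s H ->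
    x (strip H s t) = \int[P]_(w in H) X s w - \int[P]_(w in H) X t w.

Lemma increments_locally_equal x y X : ba P x -> ba P y ->
  represents_increments x X -> represents_increments y X -> locally_equal F x y.
Proof.
move=> bx by_ xX yX d A /elementary_section[FA AE].
have mA st : st \in steps d -> measurable [set w | A (w, st.2)].
  by case: st => s t /FA; exact: Fm.
rewrite AE (@additive_elementary x _ (fun st => [set w | A (w, st.2)]))//.
rewrite (@additive_elementary y _ (fun st => [set w | A (w, st.2)]))//.
apply: eq_big_seq => -[s t] std /=; have [_ _ st _] := steps_consecutive std.
by rewrite xX ?yX ?(ltW st)//; exact: FA.
Qed.

End elementary_sets_theory.

(** * The measure of a quasi-martingale *)

Section quasi_martingale_measure.
Context {dO : measure_display} {Omega : measurableType dO} {R : realType}.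
Context {dD : Order.disp_t} {Delta : orderType dD}.
Variables (P : probability Omega R) (F : Delta -> set (set Omega)).
Variable L : ({fset Delta} -> R) -> R.
Hypotheses (hP : measure_is_complete P) (hF : filtration P F).
Hypothesis hL : banach_limit L.
Variable t0 : Delta.
Implicit Types (X Y : Delta -> Omega -> R) (d : {fset Delta}).
Implicit Types (x y : set (Omega * Delta) -> R) (f : Omega * Delta -> R).
Implicit Types (s t : Delta).

Let sF t : sigma_algebra setT (F t). Proof. by case: hF. Qed.
Let Fm t : F t `<=` measurable. Proof. by case: hF. Qed.
Let sB := @sigma_algebra_barF _ Omega R _ Delta P.

Definition qm_functional X f : R := - L (fun d => approx_pairing P F d f X).

Definition qm_measure X (A : set (Omega * Delta)) : R := qm_functional X \1_A.

Lemma integral_d_variation X d : L1_process P F X ->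
  (\int[P]_w (d_variation P F d X w)%:E)%E =
  (\int[P]_w d_variation P F d X w)%:E.
Proof.
move=> hX; rewrite /Rintegral fineK//; apply: integrable_fin_num => //.
exact: integrable_d_variation.
Qed.

Lemma quasi_norm_ge0 X : (0 <= quasi_norm P F X)%E.
Proof.
apply: le_trans (ereal_sup_ubound _); last by exists fset0.
by apply: integral_ge0 => w _; rewrite lee_fin sumr_ge0.
Qed.

Lemma Rintegral_d_variation_le X d : quasi_martingale P F X ->
  \int[P]_w d_variation P F d X w <= fine (quasi_norm P F X).
Proof.
move=> [hX nX]; rewrite -lee_fin -integral_d_variation// fineK.
  by apply: ereal_sup_ubound; exists d.
by rewrite ge0_fin_numE// quasi_norm_ge0.
Qed.

Section fixed_process.
Variable X : Delta -> Omega -> R.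
Hypothesis qX : quasi_martingale P F X.
Let hX : L1_process P F X. Proof. by case: qX. Qed.
Let K := fine (quasi_norm P F X).

Lemma approx_pairing_bound d f M : bounded_measurable (barF P) f ->
  (forall p, `|f p| <= M) -> `|approx_pairing P F d f X| <= K * M.
Proof.
move=> bf fM; rewrite (le_trans (approx_pairing_le hP hF hX d bf fM))//.
apply: ler_wpM2r; last exact: Rintegral_d_variation_le.
exact: le_trans (normr_ge0 _) (fM (point, t0)).
Qed.

Lemma bounded_approx_pairing f : bounded_measurable (barF P) f ->
  [bounded approx_pairing P F d f X | d in setT].
Proof.
move=> bf; have [_ /boundedP[M fM]] := bf.
by apply/boundedP; exists (K * M) => d; exact: approx_pairing_bound.
Qed.

Lemma qm_functional_le f M : bounded_measurable (barF P) f ->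
  (forall p, `|f p| <= M) -> `|qm_functional X f| <= K * M.
Proof.
move=> bf fM; rewrite normrN; apply: banach_limit_le => // d.
exact: approx_pairing_bound.
Qed.

Lemma qm_functional_bounded : bounded_functional (barF P) (qm_functional X).
Proof.
split=> [a f g bf bg|]; last by exists K => f M; exact: qm_functional_le.
rewrite /qm_functional mulrN -opprD; congr (- _).
case: hL => lin _ _; rewrite -lin; [|exact: bounded_approx_pairing..].
congr L; apply/funext => d.
rewrite !approx_pairingE//; last first.
  apply: bounded_measurableD => //; apply: bounded_measurableM => //.
  exact: bounded_measurable_cst.
rewrite mulr_sumr -big_split; apply: eq_bigr => -[s t] _ /=.
have bft := bounded_measurable_section hP t bf.
have bgt := bounded_measurable_section hP t bg.
have iD := integrable_drift hF hX s t.
under eq_Rintegral do rewrite mulrDl -mulrA.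
rewrite RintegralD// ?RintegralZl//; [exact: integrable_rvM| |exact: integrable_rvM].
exact/integrable_rvZ/integrable_rvM.
Qed.

(** The net is constant as soon as [d] contains [s] and [t]. *)
Lemma qm_functional_tensor s t (c : Omega -> R) : (s <= t)%O ->
  bounded_measurable (F s) c ->
  qm_functional X (fun p => c p.1 * \1_(`]s, t]%classic : set Delta) p.2) =
  \int[P]_w (c w * X s w) - \int[P]_w (c w * X t w).
Proof.
move=> st bc; rewrite -opprB; congr (- _).
apply: (@banach_limit_eventually _ _ _ L hL _ _ [fset s; t]%fset).
  apply/bounded_approx_pairing/bounded_measurable_tensor.
  exact: bounded_measurable_sub (@Fm s) bc.
move=> d /fsubsetP dst; apply: approx_pairing_tensor => //.
  by apply: dst; rewrite !inE eqxx.
by apply: dst; rewrite !inE eqxx orbT.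
Qed.

Lemma qm_measure_increments : represents_increments P F (qm_measure X) X.
Proof.
move=> s t H st FH; rewrite /qm_measure.
rewrite (_ : \1_(strip H s t) = fun p =>
    \1_H p.1 * \1_(`]s, t]%classic : set Delta) p.2); last first.
  by apply/funext => p; rewrite !indicE in_setX -natrM mulnb.
rewrite qm_functional_tensor//; last exact: bounded_measurable_indic.
by rewrite -!Rintegral_indic.
Qed.

Lemma qm_measure_le A : barF P A -> `|qm_measure X A| <= K.
Proof.
move=> mA; rewrite -[K]mulr1; apply: qm_functional_le.
  exact: bounded_measurable_indic.
by move=> p; rewrite indicE ger0_norm// lern1; case: (_ \in _).
Qed.

Lemma qm_measure_ba : ba P (qm_measure X).
Proof.
split.
- move=> A B mA mB AB; rewrite -(bounded_functionalD qm_functional_bounded).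
  + congr (qm_functional X _); apply/funext => p; rewrite !indicE in_setU.
    have [pA|_] := boolP (p \in A); last by rewrite add0r.
    have [pB|_] := boolP (p \in B); last by rewrite addr0.
    have : (A `&` B) p by rewrite inE in pA; rewrite inE in pB.
    by rewrite AB.
  + exact: bounded_measurable_indic.
  + exact: bounded_measurable_indic.
- by exists K => A; exact: qm_measure_le.
- move=> A eA; rewrite /qm_measure /qm_functional.
  rewrite (_ : (fun d => _) = fun=> 0) ?banach_limit_cst ?oppr0//.
  apply/funext => d; rewrite approx_pairingE//; last first.
    by apply: bounded_measurable_indic => //; exact: barF_evanescent.
  apply: big1 => -[s t] _ /=.
  have mA : measurable [set w | A (w, t)].
    exact: (barF_section hP t (barF_evanescent eA)).
  transitivity (\int[P]_(w in [set w | A (w, t)]) drift P F X s t w).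
    rewrite [RHS]Rintegral_indic; apply: eq_Rintegral => w _.
    by rewrite !indicE; congr (_%:R * _); congr nat_of_bool;
      apply/idP/idP; rewrite !inE.
  rewrite /Rintegral null_set_integral//.
    exact/measurable_funTS/(measurable_int _ (integrable_drift hF hX s t)).
  apply/(negligibleP P mA); case: eA => N [mN N0 AN]; exists N; split => // w Aw.
  by apply: AN; exists (w, t).
Qed.

(** The value at an elementary set is a finite sum over the steps of integrals of
    increments over the sections of the set, and each of these is countably
    additive as an indefinite integral. *)
Lemma qm_measure_countably_additive d :
  countably_additive_on (elementary_sets F d) (qm_measure X).
Proof.
move=> A EA tA EUA.
have xE B : elementary_sets F d B -> qm_measure X B = \sum_(st <- steps d)
    \int[P]_(w in [set w | B (w, st.2)]) (X st.1 w - X st.2 w).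
  move=> /elementary_section[FB BE].
  rewrite [in LHS]BE (additive_elementary (K := fun st => [set w | B (w, st.2)]) qm_measure_ba).
    apply: eq_big_seq => -[s t] std /=; have [_ _ st _] := steps_consecutive std.
    have mB := Fm (FB _ _ std).
    rewrite (qm_measure_increments (ltW st)) ?RintegralB//; last exact: FB.
    - by apply: integrableS (measurableT) _ _ _ => //; exact: L1_integrable hX s.
    - by apply: integrableS (measurableT) _ _ _ => //; exact: L1_integrable hX t.
  by move=> [s t] /FB; exact: Fm.
have sumE n : \sum_(0 <= k < n) qm_measure X (A k) =
    \sum_(st <- steps d | st \in steps d) \sum_(0 <= k < n)
      \int[P]_(w in [set w | A k (w, st.2)]) (X st.1 w - X st.2 w).
  by rewrite -big_seq exchange_big; apply: eq_bigr => k _; rewrite xE.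
rewrite (funext sumE) (xE _ EUA) big_seq.
apply: cvg_big => [|[s t] std /=]; first exact: add_continuous.
apply: (countably_additive_Rintegral (U := fun w => X s w - X t w)).
- by apply: integrable_rvB; [exact: L1_integrable hX s|exact: L1_integrable hX t].
- by move=> n; have [FA _] := elementary_section (EA n); apply: Fm (FA _ _ std).
- apply/trivIsetP => i j _ _ ij; move/trivIsetP : tA => /(_ i j I I ij) Aij.
  by apply/seteqP; split => // w Aw; have : set0 (w, t) by rewrite -Aij.
- have [FA _] := elementary_section EUA.
  exact: Fm (FA _ _ std).
Qed.

End fixed_process.
End quasi_martingale_measure.

(** * Signs of random variables and of their integrals *)

Section almost_everywhere_sign.
Context {dO : measure_display} {Omega : measurableType dO} {R : realType}.
Variable P : probability Omega R.
Implicit Types (Z : Omega -> R).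

Lemma Rintegral_norm0_ae Z : integrable_rv P Z -> \int[P]_w `|Z w| <= 0 ->
  {ae P, forall w, Z w = 0}.
Proof.
move=> iZ Z0; have mZ := measurable_int _ iZ.
have /(ae_eq_integral_abs P measurableT mZ) : (\int[P]_x `|(EFin \o Z) x| = 0)%E.
  have fin := integrable_fin_num measurableT (integrable_norm iZ).
  rewrite -[LHS](fineK fin) (_ : fine _ = 0)//; apply/eqP; rewrite eq_le Z0/=.
  exact: Rintegral_ge0.
by apply: filterS => w /(_ I) [].
Qed.

Lemma Rintegral_norm_split (G : set (set Omega)) Z : G `<=` measurable ->
  measurable_wrt G Z -> integrable_rv P Z ->
  [/\ G [set w | 0 < Z w], G [set w | Z w <= 0] &
    \int[P]_w `|Z w| = \int[P]_(w in [set w | 0 < Z w]) Z w -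
                       \int[P]_(w in [set w | Z w <= 0]) Z w].
Proof.
move=> Gm mZ iZ.
have G1 : G [set w | 0 < Z w] by have := mZ _ (measurable_itv `]0, +oo[); rewrite set_itvE.
have G2 : G [set w | Z w <= 0] by have := mZ _ (measurable_itv `]-oo, 0]); rewrite set_itvE.
split => //.
have bG A : G A -> bounded_measurable measurable (\1_A : Omega -> R).
  move=> GA; apply: bounded_measurable_indic; last exact: Gm.
  exact: sigma_algebra_measurable.
rewrite (Rintegral_indic P [set w | 0 < Z w]) (Rintegral_indic P [set w | Z w <= 0]).
rewrite -RintegralB//; last 2 first.
- exact: integrable_rvM (bG _ G1) iZ.
- exact: integrable_rvM (bG _ G2) iZ.
apply: eq_Rintegral => w _; rewrite !indicE.
have [Z0|Z0] := leP (Z w) 0.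
  rewrite ler0_norm// memNset ?mem_set//; first by rewrite mul0r mul1r sub0r.
  by rewrite /= ltNge Z0.
rewrite gtr0_norm// mem_set ?memNset//; first by rewrite mul0r mul1r subr0.
by rewrite /= leNgt Z0.
Qed.

Lemma Rintegral_le0_ae (G : set (set Omega)) Z : G `<=` measurable ->
  measurable_wrt G Z -> integrable_rv P Z ->
  (forall A, G A -> \int[P]_(w in A) Z w <= 0) -> {ae P, forall w, Z w <= 0}.
Proof.
move=> Gm mZ iZ Z0; pose B := [set w | 0 < Z w].
have GB : G B by have := mZ _ (measurable_itv `]0, +oo[); rewrite set_itvE.
have bB : bounded_measurable measurable (\1_B : Omega -> R).
  apply: bounded_measurable_indic; last exact: Gm.
  exact: sigma_algebra_measurable.
have : {ae P, forall w, \1_B w * Z w = 0}.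
  apply: Rintegral_norm0_ae; first exact: integrable_rvM.
  rewrite (le_trans _ (Z0 _ GB))// (Rintegral_indic P B) le_eqVlt; apply/orP; left.
  apply/eqP; apply: eq_Rintegral => w _; rewrite ger0_norm// indicE.
  by have [|] := boolP (w \in B); rewrite ?mul0r// inE mul1r => /ltW.
apply: filterS => w; rewrite leNgt indicE => + /=; apply: contraPN => Zw.
by rewrite mem_set// mul1r => Zw0; rewrite Zw0 ltxx in Zw.
Qed.

Lemma ae_Rintegral_le0 Z : integrable_rv P Z -> {ae P, forall w, Z w <= 0} ->
  \int[P]_w Z w <= 0.
Proof.
move=> iZ [N [mN N0 ZN]].
rewrite /Rintegral (negligible_integral mN)//.
rewrite (_ : fine _ = - \int[P]_(w in setT `\` N) (- Z w)).
  rewrite oppr_le0; apply: Rintegral_ge0 => w [_ Nw]; rewrite oppr_ge0.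
  by apply: contrapT => Zw; apply/Nw/ZN.
under [in RHS]eq_Rintegral do rewrite -mulN1r.
rewrite RintegralZl ?mulN1r ?opprK//; first exact: measurableD.
by apply: integrableS (measurableT) _ _ _ => //; exact: measurableD.
Qed.

End almost_everywhere_sign.

(** * Isometry, positivity and determination by elementary sets *)

Section quasi_martingale_measure_theory.
Context {dO : measure_display} {Omega : measurableType dO} {R : realType}.
Context {dD : Order.disp_t} {Delta : orderType dD}.
Variables (P : probability Omega R) (F : Delta -> set (set Omega)).
Variable L : ({fset Delta} -> R) -> R.
Hypotheses (hP : measure_is_complete P) (hF : filtration P F).
Hypothesis hL : banach_limit L.
Variable t0 : Delta.
Implicit Types (X Y : Delta -> Omega -> R) (d : {fset Delta}).
Implicit Types (x y : set (Omega * Delta) -> R) (f : Omega * Delta -> R).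
Implicit Types (s t : Delta).

Let sF t : sigma_algebra setT (F t). Proof. by case: hF. Qed.
Let Fm t : F t `<=` measurable. Proof. by case: hF. Qed.
Let sB := @sigma_algebra_barF _ Omega R _ Delta P.

Section fixed_process.
Variable X : Delta -> Omega -> R.
Hypothesis qX : quasi_martingale P F X.
Let hX : L1_process P F X. Proof. by case: qX. Qed.
Let bS := qm_functional_bounded hP hF hL t0 qX.

Lemma fa_integral_qm_measure f : bounded_measurable (barF P) f ->
  fa_integral (qm_measure P F L X) f = qm_functional P F L X f.
Proof. exact: fa_integral_functional. Qed.

(** [P^d(f)] is a sum of tensors over the steps of [d], and on these the functional is
    given by increments. *)
Lemma qm_functional_elementary_proj d f : bounded_measurable (barF P) f ->
  qm_functional P F L X (elementary_proj P F d f) = - approx_pairing P F d f X.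
Proof.
move=> bf.
have bc s t : bounded_measurable (F s) (cond_exp P (F s) (fun w => f (w, t))).
  apply: bounded_measurable_cond_exp => //.
  exact: (bounded_measurable_section hP t bf).
rewrite (bounded_functional_sum sB bS); last first.
  move=> st; apply: bounded_measurable_tensor.
  exact: bounded_measurable_sub (@Fm st.1) (bc st.1 st.2).
rewrite approx_pairingE0// -sumrN; apply: eq_big_seq => -[s t] std /=.
have [_ _ st _] := steps_consecutive std.
by rewrite (qm_functional_tensor hP hF hL t0 qX (ltW st))// Rintegral_drift// opprB.
Qed.

(** Along [d], the integral of [P^d(f)] against the measure of [X] is the net that
    defines the integral of [f], so the Banach limits agree. *)
Lemma qm_measure_Mloc_lim : Mloc_lim P F L (qm_measure P F L X).
Proof.
split.
  split; first exact: qm_measure_ba.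
  by move=> d; exact: qm_measure_countably_additive.
move=> f bf; rewrite fa_integral_qm_measure//.
rewrite (_ : (fun d => _) = fun d => - approx_pairing P F d f X); last first.
  apply/funext => d; rewrite fa_integral_qm_measure; last first.
    exact: bounded_measurable_elementary_proj.
  by rewrite qm_functional_elementary_proj.
by rewrite banach_limitN//; exact: (bounded_approx_pairing hP hF t0 qX).
Qed.

Lemma corresponds_qm_measure x : ba P x ->
  corresponds P F L x X <-> agree_on (barF P) x (qm_measure P F L X).
Proof.
move=> [xU _ x0]; split => [xX A mA|xX f bf].
  rewrite -(fa_integral_indic A (additive_set0 sB xU)).
  by rewrite xX//; exact: bounded_measurable_indic.
by rewrite (fa_integral_agree sB xX bf) fa_integral_qm_measure.
Qed.

(** The sum of the [|x (A i)|] is the integral of a function that is the sign of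
    [x (A i)] on [A i], hence is bounded by 1. *)
Lemma fa_variation_qm_measure_le :
  (fa_variation (barF P) (qm_measure P F L X) <= quasi_norm P F X)%E.
Proof.
have KE : quasi_norm P F X = (fine (quasi_norm P F X))%:E.
  by case: (qX) => _ nX; rewrite fineK// ge0_fin_numE// quasi_norm_ge0.
apply: ge_ereal_sup => _ [n [A [mA tA ->]]]; rewrite KE lee_fin.
pose x := qm_measure P F L X.
(* Each point lies in at most one [A i], so that [f] is bounded by 1. *)
pose f p := \sum_(i < n) Num.sg (x (A i)) * (\1_(A i) p : R).
have bi i : bounded_measurable (barF P) (\1_(A i) : _ -> R).
  exact: bounded_measurable_indic.
have bsi i : bounded_measurable (barF P) (fun p => Num.sg (x (A i)) * (\1_(A i) p : R)).
  by apply: bounded_measurableM => //; exact: bounded_measurable_cst.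
have fE : qm_functional P F L X f = \sum_(i < n) `|x (A i)|.
  rewrite (bounded_functional_sum sB bS)//; apply: eq_bigr => i _.
  by rewrite (bounded_functionalZ sB bS)// normrEsg.
rewrite -fE (le_trans (ler_norm _))// -[leRHS]mulr1.
apply: qm_functional_le => //; first exact: bounded_measurable_sum.
move=> p; have [[i Aip]|nA] := pselect (exists i, A i p).
  rewrite /f (bigD1 i)//= big1 => [|j ji].
    rewrite addr0 indicE mem_set// mulr1 normr_sg.
    by rewrite lern1; case: (_ == _).
  rewrite indicE memNset ?mulr0// => Ajp; move/eqP: ji; apply.
  by apply: tA => //; exists p.
rewrite /f big1 ?normr0// => i _; rewrite indicE memNset ?mulr0// => Aip.
by apply: nA; exists i.
Qed.

Lemma qm_measure_nonneg : supermartingale P F X ->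
  nonneg_on (barF P) (qm_measure P F L X).
Proof.
move=> [_ sX] A mA; rewrite /qm_measure /qm_functional.
have bA : bounded_measurable (barF P) (\1_A : _ -> R) by exact: bounded_measurable_indic.
have bnet := bounded_approx_pairing hP hF t0 qX bA.
rewrite -banach_limitN//; case: (hL) => _ pos _; apply: pos.
  by case/boundedP: bnet => M hM; apply/boundedP; exists M => d; rewrite normrN.
move=> d; rewrite oppr_ge0 approx_pairingE// big_seq sumr_le0// => -[s t] std /=.
have [_ _ st _] := steps_consecutive std.
apply: ae_Rintegral_le0.
  by apply: integrable_rvM; [exact: (bounded_measurable_section hP t bA)|exact: integrable_drift].
apply: filterS (sX _ _ (ltW st)) => w sw; rewrite indicE.
by case: (_ \in _); rewrite ?mul0r// mul1r subr_le0.
Qed.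

End fixed_process.

Lemma agree_on_sym (T : Type) (G : set (set T)) (x y : set T -> R) :
  agree_on G x y -> agree_on G y x.
Proof. by move=> xy A /xy ->. Qed.

Lemma ba_agree x y : agree_on (barF P) x y -> ba P x -> ba P y.
Proof.
move=> xy [xU [M xM] x0]; split.
- move=> A B mA mB AB; rewrite -(xy _ mA) -(xy _ mB) -xy ?xU//.
  exact: (sigma_setU sB).
- by exists M => A mA; rewrite -xy ?xM.
- by move=> A eA; rewrite -xy ?x0//; exact: barF_evanescent.
Qed.

Lemma Mloc_lim_agree x y : agree_on (barF P) x y ->
  Mloc_lim P F L x -> Mloc_lim P F L y.
Proof.
move=> xy [[bx cx] lx]; split.
  split; first exact: ba_agree bx.
  move=> d A EA tA EUA; have EB := elementary_sets_barF hF.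
  rewrite -xy; last exact: EB EUA.
  have xyE n : \sum_(0 <= k < n) y (A k) = \sum_(0 <= k < n) x (A k).
    by apply: eq_bigr => k _; rewrite xy//; exact: EB (EA k).
  by rewrite (funext xyE); exact: cx.
move=> f bf; rewrite -(fa_integral_agree sB xy bf) lx//; congr L.
apply/funext => d; apply: (fa_integral_agree sB xy).
exact: bounded_measurable_elementary_proj.
Qed.

(** The level sets of a function of the form [elementary_proj d f], other than
    that of level 0, are elementary sets; so are those of its dyadic
    approximations, since these fix 0. *)
Lemma fa_integral_elementary_proj x y d f : locally_equal F x y ->
  bounded_measurable (barF P) f ->
  fa_integral x (elementary_proj P F d f) = fa_integral y (elementary_proj P F d f).
Proof.
move=> xy bf.
have E n : simple_integral x (dyadic_step (elementary_proj P F d f) n) =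
           simple_integral y (dyadic_step (elementary_proj P F d f) n).
  rewrite /simple_integral; apply: (@eq_fsbigr _ _ +%R) => r _.
  have [->|r0] := eqVneq r 0; first by rewrite !mul0r.
  congr (_ * _); apply: (xy d).
  pose c (st : Delta * Delta) := cond_exp P (F st.1) (fun w => f (w, st.2)).
  rewrite (_ : _ @^-1` _ = \bigcup_(st in [set` steps d])
      strip ((dyadic_step (c st) n) @^-1` [set r]) st.1 st.2).
    apply: (elementary_sets_pairs hF) => -[s t] _.
    apply: (measurable_wrt_dyadic_step n (sF s)) => //.
    have [] // : bounded_measurable (F s) (c (s, t)).
    by apply: bounded_measurable_cond_exp => //; exact: (bounded_measurable_section hP _ bf).
  apply/seteqP; split => [[w u] /= hr|[w u] [[s t] std [/= hr su]]]; last first.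
    rewrite in_itv/= in su; rewrite -hr /dyadic_step /elementary_proj /=.
    by rewrite (sum_steps_indic (fun st => c st w) std su).
  have [[[s t] std su]|nst] :=
      pselect (exists2 st, st \in steps d & (st.1 < u <= st.2)%O).
    exists (s, t) => //; split => /=; last by rewrite in_itv.
    rewrite -hr /dyadic_step /elementary_proj /=.
    by rewrite (sum_steps_indic (fun st => c st w) std su).
  move: r0; rewrite -hr /dyadic_step /elementary_proj /=.
  rewrite (sum_steps_indic0 (fun st => c st w)) ?mulr0 ?floor0 ?mul0r ?eqxx//.
  by move=> s t std; apply/negP => su; apply: nst; exists (s, t).
by rewrite /fa_integral; under eq_fun do rewrite E.
Qed.

(** Both measures are the same Banach limit of the integrals of the [P^d(f)], which
    only involve elementary sets. *)
Lemma Mloc_lim_unique x y : Mloc_lim P F L x -> Mloc_lim P F L y ->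
  locally_equal F x y -> agree_on (barF P) x y.
Proof.
move=> [[[xU _ _] _] lx] [[[yU _ _] _] ly] xy A mA.
have bA : bounded_measurable (barF P) (\1_A : _ -> R) by exact: bounded_measurable_indic.
rewrite -(fa_integral_indic A (additive_set0 sB xU)).
rewrite -(fa_integral_indic A (additive_set0 sB yU)).
rewrite lx// ly//; congr L; apply/funext => d.
exact: fa_integral_elementary_proj.
Qed.

Section represented_measures.
Variables (x : set (Omega * Delta) -> R) (X : Delta -> Omega -> R).
Hypotheses (bx : ba P x) (hX : L1_process P F X).
Hypothesis xX : represents_increments P F x X.

Lemma Rintegral_drift_strip s t H : (s <= t)%O -> F s H ->
  \int[P]_(w in H) drift P F X s t w = - x (strip H s t).
Proof.
move=> st FH; rewrite xX// Rintegral_indic Rintegral_drift//; last first.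
  exact: bounded_measurable_indic.
by rewrite opprB -!Rintegral_indic.
Qed.

(** Splitting each strip according to the sign of the drift turns the mean
    variation of [X] along [d] into a difference of two values of [x]. *)
Lemma d_variation_witness d : exists A1 A2,
  [/\ elementary_sets F d A1, elementary_sets F d A2, A1 `&` A2 = set0 &
      \int[P]_w d_variation P F d X w = x A1 - x A2].
Proof.
pose K1 (st : Delta * Delta) := [set w | drift P F X st.1 st.2 w <= 0].
pose K2 (st : Delta * Delta) := [set w | 0 < drift P F X st.1 st.2 w].
have FK1 st : F st.1 (K1 st).
  have := measurable_drift hF hX st.1 st.2 (measurable_itv `]-oo, 0]).
  by rewrite set_itvE.
have FK2 st : F st.1 (K2 st).
  have := measurable_drift hF hX st.1 st.2 (measurable_itv `]0, +oo[).
  by rewrite set_itvE.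
exists (\bigcup_(st in [set` steps d]) strip (K1 st) st.1 st.2).
exists (\bigcup_(st in [set` steps d]) strip (K2 st) st.1 st.2).
split.
- by apply: (elementary_sets_pairs hF) => st _.
- by apply: (elementary_sets_pairs hF) => st _.
- apply/seteqP; split => // p [[st std h] [st' std' h']].
  have e := strip_disjoint std std' h h'; rewrite e in h.
  by case: h h' => [/= h _] [/= h' _]; move: h; rewrite /K1/= leNgt h'.
rewrite Rintegral_d_variation// !(additive_elementary bx); last 2 first.
- by move=> st _; exact: Fm.
- by move=> st _; exact: Fm.
rewrite -sumrB; apply: eq_big_seq => -[s t] std /=.
have [_ _ st _] := steps_consecutive std.
have [F2 F1 ->] := Rintegral_norm_split (@Fm s) (measurable_drift hF hX s t)
  (integrable_drift hF hX s t).
by rewrite !Rintegral_drift_strip ?(ltW st)// opprK addrC.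
Qed.

Lemma quasi_norm_le_fa_variation :
  (quasi_norm P F X <= fa_variation (barF P) x)%E.
Proof.
apply: ge_ereal_sup => _ [d _ <-]; rewrite integral_d_variation//.
have [A1 [A2 [E1 E2 A12 ->]]] := d_variation_witness d.
apply: (@le_trans _ _ (`|x A1| + `|x A2|)%:E).
  by rewrite lee_fin (le_trans (ler_norm _))// ler_normB.
apply: ereal_sup_ubound; exists 2%N, (fun i : 'I_2 => if i == ord0 then A1 else A2).
split.
- by move=> i; case: ifP => _; exact: (elementary_sets_barF hF (d := d)).
- apply/trivIsetP => -[[|[|//]] hi] [[|[|//]] hj] _ _ //= _.
  by rewrite setIC.
- by rewrite big_ord_recr big_ord1.
Qed.

Lemma quasi_martingale_represented : quasi_martingale P F X.
Proof.
split=> //; have [_ [M xM] _] := bx.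
apply: (@le_lt_trans _ _ (M + M)%:E); last exact: ltry.
apply: ge_ereal_sup => _ [d _ <-]; rewrite integral_d_variation//.
have [A1 [A2 [E1 E2 A12 ->]]] := d_variation_witness d.
rewrite lee_fin (le_trans (ler_norm _))// (le_trans (ler_normB _ _))// lerD//.
  by apply: xM; exact: elementary_sets_barF E1.
by apply: xM; exact: elementary_sets_barF E2.
Qed.

(** The integrals of the drift over the sets of [F s] are values of [- x]. *)
Lemma supermartingale_represented : nonneg_on (barF P) x -> supermartingale P F X.
Proof.
move=> x0; split => // s t st.
have := Rintegral_le0_ae (@Fm s) (measurable_drift hF hX s t) (integrable_drift hF hX s t).
case=> [A FA|N [mN N0 DN]].
  rewrite Rintegral_drift_strip// oppr_le0; apply: x0; apply: barF_strip; exact: Fm FA.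
by exists N; split => // w Xw; apply: DN => /=; rewrite subr_le0.
Qed.

End represented_measures.

End quasi_martingale_measure_theory.

(** * Tails and limits of a locally countably additive measure *)

Section potential_of_measure.
Context {dO : measure_display} {Omega : measurableType dO} {R : realType}.
Context {dD : Order.disp_t} {Delta : orderType dD}.
Variables (P : probability Omega R) (F : Delta -> set (set Omega)).
Hypotheses (hF : filtration P F).
Variable t0 : Delta.
Implicit Types (d : {fset Delta}) (s t r u : Delta) (H : set Omega).

Let sF t : sigma_algebra setT (F t). Proof. by case: hF. Qed.
Let Fm t : F t `<=` measurable. Proof. by case: hF. Qed.
Let Fle s t : (s <= t)%O -> F s `<=` F t. Proof. by case: hF => _ _ h _; exact: h. Qed.
Let sB := @sigma_algebra_barF _ Omega R _ Delta P.

Lemma steps_pair t r : (t < r)%O -> steps [fset t; r]%fset = [:: (t, r)].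
Proof.
move=> tr; rewrite /steps (_ : sort _ _ = [:: t; r])//.
apply: (sorted_eq le_trans le_anti) => /=; last first.
- apply: uniq_perm; rewrite ?sort_uniq ?fset_uniq//=.
    by rewrite inE andbT lt_eqF.
  by move=> u; rewrite mem_sort !inE.
- by rewrite (ltW tr).
- by apply: sort_sorted; exact: le_total.
Qed.

Lemma elementary_strip t r H : (t < r)%O -> F t H ->
  elementary_sets F [fset t; r]%fset (strip H t r).
Proof.
move=> tr FH; have := @elementary_sets_pairs _ _ R _ _ P F hF [fset t; r]%fset (fun=> H).
rewrite (_ : [set` steps _] = [set (t, r)]) ?bigcup_set1.
  by apply=> st; rewrite steps_pair// inE => /eqP ->.
by apply/seteqP; split => st /=; rewrite steps_pair// inE => /eqP.
Qed.

Section tails.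
Variable x : set (Omega * Delta) -> R.
Hypothesis bx : ba P x.

Lemma strip_split s t r H : (s <= t)%O -> (t <= r)%O -> measurable H ->
  x (strip H s r) = x (strip H s t) + x (strip H t r).
Proof.
move=> st tr mH; case: bx => xU _ _; rewrite -xU.
- congr x; apply/seteqP; split => -[w u]; rewrite /strip /=.
    move=> [Hw /=]; rewrite in_itv/= => /andP[su ur].
    have [ut|tu] := leP u t; [left|right]; split => //=; rewrite in_itv/=.
      by rewrite su ut.
    by rewrite tu ur.
  move=> [] [Hw /=]; rewrite in_itv/= => /andP[h1 h2]; split => //=; rewrite in_itv/=.
    by rewrite h1 (le_trans h2).
  by rewrite h2 (le_lt_trans st).
- exact: barF_strip.
- exact: barF_strip.
- apply/seteqP; split => // -[w u] [] [_ /=]; rewrite in_itv/= => /andP[_ ut].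
  by move=> [_ /=]; rewrite in_itv/= ltNge ut.
Qed.

Lemma stripU s t A B : measurable A -> measurable B -> A `&` B = set0 ->
  x (strip (A `|` B) s t) = x (strip A s t) + x (strip B s t).
Proof.
move=> mA mB AB; case: bx => xU _ _; rewrite -xU; [|exact: barF_strip..|].
  congr x; apply/seteqP; split => [p [[Ap|Bp] h]|p [[Ap h]|[Bp h]]].
  - by left.
  - by right.
  - by split => //; left.
  - by split => //; right.
apply/seteqP; split => // p [[Ap _] [Bp _]].
by have : (A `&` B) p.1 by []; rewrite AB.
Qed.

Lemma strip_empty H s : x (strip H s s) = 0.
Proof.
case: bx => _ _ x0; apply: x0; rewrite (_ : strip H s s = set0).
  by rewrite /evanescent/= image_set0; exact: negligible_set0.
apply/seteqP; split => // -[w u] [_ /=]; rewrite in_itv/= => /andP[su us].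
by have := lt_le_trans su us; rewrite ltxx.
Qed.

End tails.

(** A set whose value nearly attains the supremum of [x] over the sets that are
    bounded above in [Delta] leaves almost nothing for the sets beyond it. *)
Lemma ba_tail_le x (e : R) : ba P x -> 0 < e ->
  exists u, forall C t, barF P C -> C `<=` setT `*` `]u, t]%classic -> x C <= e.
Proof.
move=> bx e0; have [xU [M xM] x0] := bx.
pose V := [set x B | B in [set B | barF P B /\ exists t, forall p, B p -> (p.2 <= t)%O]].
have V0 : V !=set0.
  by exists (x set0), set0 => //; split; [case: sB|exists t0].
have VM : has_ubound V.
  by exists M => _ [B [mB _] <-]; exact: le_trans (ler_norm _) (xM _ mB).
have [_ [B [mB [u Bu]] <-] Bsup] := sup_adherent e0 (conj V0 VM).
exists u => C t mC Ct.
have CE p : C p -> (u < p.2 <= t)%O by move=> /Ct[_ /=]; rewrite in_itv.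
have : x (B `|` C) <= sup V.
  apply: ub_le_sup => //; exists (B `|` C) => //; split; first exact: (sigma_setU sB).
  exists (Order.max u t) => p [/Bu pu|/CE/andP[_ pt]]; rewrite le_max ?pu// pt.
  by rewrite orbT.
rewrite xU//; first lra.
apply/seteqP; split => // p [/Bu pu /CE/andP[up _]].
by have := lt_le_trans up pu; rewrite ltxx.
Qed.

(** The one-sided bound applies to both [x] and [- x]. *)
Lemma ba_tail x (e : R) : ba P x -> 0 < e ->
  exists u, forall C t, barF P C -> C `<=` setT `*` `]u, t]%classic -> `|x C| <= e.
Proof.
move=> bx e0; have bNx : ba P (fun A => - x A).
  case: bx => xU [M xM] x0; split=> [A B mA mB AB||A eA].
  - by rewrite xU// opprD.
  - by exists M => A mA; rewrite normrN xM.
  - by rewrite x0// oppr0.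
have [u1 h1] := ba_tail_le bx e0; have [u2 h2] := ba_tail_le bNx e0.
exists (Order.max u1 u2) => C t mC Ct.
have sub u : (u <= Order.max u1 u2)%O -> C `<=` setT `*` `]u, t]%classic.
  move=> uu p /Ct[_ /=]; rewrite in_itv/= => /andP[up pt]; split => //=.
  by rewrite in_itv/= pt (le_lt_trans uu up).
rewrite ler_norml lerNl (h2 _ t) ?(h1 _ t)//.
  by apply: sub; rewrite le_max lexx.
by apply: sub; rewrite le_max lexx orbT.
Qed.

Section limit_measures.
Variable x : set (Omega * Delta) -> R.
Hypothesis hx : Mloc P F x.
Let bx : ba P x. Proof. by case: hx. Qed.

Variable u : nat -> Delta.
Hypothesis uP : forall n C t, barF P C -> C `<=` setT `*` `]u n, t]%classic ->
  `|x C| <= n.+1%:R^-1.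

Let tail n t H : R := x (strip H t (Order.max (u n) t)).

(** The two tails differ by a strip lying beyond [u n] or beyond [u m], according to
    which of the two reaches further. *)
Lemma tail_dist n m t H : measurable H ->
  `|tail n t H - tail m t H| <= n.+1%:R^-1 + m.+1%:R^-1.
Proof.
move=> mH; wlog nm : n m / (Order.max (u n) t <= Order.max (u m) t)%O => [hw|].
  have /orP[/hw//|/hw] := le_total (Order.max (u n) t) (Order.max (u m) t).
  by rewrite distrC (addrC m.+1%:R^-1).
rewrite /tail (strip_split bx _ nm mH) ?le_max ?lexx ?orbT//.
rewrite opprD addrA subrr sub0r normrN (@le_trans _ _ n.+1%:R^-1)//; last first.
  by rewrite lerDl invr_ge0.
apply: (uP (t := Order.max (u m) t)); first exact: barF_strip.
move=> p [_ /=]; rewrite in_itv/= => /andP[h1 h2]; split => //=.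
rewrite in_itv/= h2 andbT; apply: le_lt_trans h1.
by rewrite le_max lexx.
Qed.

Lemma eps_small (e : R) : 0 < e -> \forall n \near \oo, n.+1%:R^-1 <= e.
Proof.
move=> e0; have /cvgrPdist_le /(_ e e0) := @cvg_harmonic R.
by apply: filterS => n; rewrite sub0r normrN ger0_norm// harmonic_ge0.
Qed.

Lemma tail_cvg t H : measurable H -> cvg (tail n t H @[n --> \oo]).
Proof.
move=> mH; apply/cauchy_cvgP/cauchy_exP => e e0.
have e4 : 0 < e / 4 by rewrite divr_gt0.
have [n hn] := filter_ex (eps_small e4).
exists (tail n t H); apply: filterS (eps_small e4) => m hm.
rewrite -ball_normE /ball_/= (le_lt_trans (tail_dist _ _ _ mH))//.
rewrite /= in hn hm.
by move: (n.+1%:R^-1 : R) (m.+1%:R^-1 : R) hn hm => a b; lra.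
Qed.

(** The mass that [x] assigns to [H * ]t, +oo[] in the limit along [u]. The set itself
    need not be bounded above in [Delta], and [x] may give it a different value. *)
Definition limit_measure t H : R := lim (tail n t H @[n --> \oo]).

Lemma limit_measure_dist n t H : measurable H ->
  `|limit_measure t H - tail n t H| <= n.+1%:R^-1.
Proof.
move=> mH; apply/ler_addgt0Pr => e e0.
have e2 : 0 < (e : R) / 2 by rewrite divr_gt0.
have /cvgrPdist_le /(_ _ e2) h := tail_cvg (t := t) mH.
have [m [/= h1 h2]] := filter_ex (filterI h (eps_small e2)).
apply: (le_trans (ler_distD (tail m t H) _ _)).
have eE (a b : R) : a + b = b / 2 + (b / 2 + a) by lra.
rewrite [leRHS]eE lerD// (le_trans (tail_dist _ _ _ mH))//.
by rewrite lerD2r.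
Qed.

Lemma limit_measure_cvg t H : measurable H ->
  tail n t H @[n --> \oo] --> limit_measure t H.
Proof. exact: tail_cvg. Qed.

(** Subtracting the tails beyond [t] from those beyond [s] leaves []s, t]], up to a
    strip beyond [u n] when [t] exceeds [u n]; the mass of this strip tends to 0. *)
Lemma limit_measure_increments s t H : (s <= t)%O -> measurable H ->
  x (strip H s t) = limit_measure s H - limit_measure t H.
Proof.
move=> st mH.
have cvg1 : tail n s H - tail n t H @[n --> \oo] --> limit_measure s H - limit_measure t H.
  by apply: cvgB; exact: limit_measure_cvg.
suff cvg2 : tail n s H - tail n t H @[n --> \oo] --> x (strip H s t).
  by rewrite -(cvg_lim _ cvg1)// (cvg_lim _ cvg2).
apply/cvgrPdist_le => e e0; apply: filterS (eps_small e0) => n.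
apply: le_trans.
have smax : (s <= Order.max (u n) s)%O by rewrite le_max lexx orbT.
have ss : (Order.max (u n) s <= Order.max (u n) t)%O.
  by rewrite ge_max !le_max lexx st orbT.
have tmax : (t <= Order.max (u n) t)%O by rewrite le_max lexx orbT.
have h1 := strip_split bx st tmax mH.
have h2 := strip_split bx smax ss mH.
rewrite (_ : _ - _ = x (strip H (Order.max (u n) s) (Order.max (u n) t))).
  apply: (uP (t := Order.max (u n) t)); first exact: barF_strip.
  move=> p [_ /=]; rewrite in_itv/= => /andP[h3 h4]; split => //=.
  by rewrite in_itv/= h4 andbT; apply: le_lt_trans h3; rewrite le_max lexx.
by rewrite /tail; lra.
Qed.

Lemma limit_measureU t A B : measurable A -> measurable B -> A `&` B = set0 ->
  limit_measure t (A `|` B) = limit_measure t A + limit_measure t B.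
Proof.
move=> mA mB AB; have mAB := measurableU _ _ mA mB.
have cvg1 : tail n t A + tail n t B @[n --> \oo] --> limit_measure t A + limit_measure t B.
  by apply: cvgD; exact: limit_measure_cvg.
rewrite -(cvg_lim _ cvg1)//.
have -> : (fun n => tail n t A + tail n t B) = fun n => tail n t (A `|` B).
  by apply/funext => n; rewrite /tail stripU.
by [].
Qed.

Lemma limit_measure_null t N : P N = 0%E -> measurable N -> limit_measure t N = 0.
Proof.
move=> N0 mN; rewrite /limit_measure (_ : (fun n => _) = fun=> 0) ?lim_cst//.
apply/funext => n; case: bx => _ _ x0; apply: x0.
by exists N; split => // w [[w' r] [Nw _] <-].
Qed.

(** The convergence of [tail n t] to [limit_measure t] is uniform over the sets,
    so the limit inherits the countable additivity of its terms. *)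
Lemma limit_measure_countably_additive t :
  countably_additive_on (F t) (limit_measure t).
Proof.
move=> A FA tA FUA.
have mA k : measurable (A k) by exact: Fm (FA k).
pose S N := \bigcup_(k in [set` iota 0 N]) A k.
have mS N : measurable (S N).
  by apply: fin_bigcup_measurable => //; exact: finite_seq.
have sumE y : (forall A B, measurable A -> measurable B -> A `&` B = set0 ->
    y (A `|` B) = y A + y B) -> forall N, \sum_(0 <= k < N) y (A k) = y (S N) :> R.
  move=> yU N; rewrite (additive_bigcup_seq (@sigma_algebra_measurable _ _) yU)//.
  - by rewrite /index_iota subn0.
  - exact: iota_uniq.
  - by move=> i j w _ _ Ai Aj; apply: tA => //; exists w.
rewrite (funext (sumE _ (@limit_measureU t))).
(* An [e / 3] argument between [limit_measure t] and [tail n t], with [n] fixed and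
   independent of the sets. *)
apply/cvgrPdist_le => e e0; have e3 : 0 < (e : R) / 3 by rewrite divr_gt0.
have [n hn] := filter_ex (eps_small e3); rewrite /= in hn.
have tU B C : measurable B -> measurable C -> B `&` C = set0 ->
    tail n t (B `|` C) = tail n t B + tail n t C by exact: stripU.
have tcvg : tail n t (S N) @[N --> \oo] --> tail n t (\bigcup_k A k).
  rewrite -(funext (sumE _ tU)) /tail; set r := Order.max _ _.
  have : (t <= r)%O by rewrite le_max lexx orbT.
  rewrite le_eqVlt => /predU1P[<-|tr].
    rewrite (strip_empty bx); under eq_fun do under eq_bigr do rewrite (strip_empty bx).
    by under eq_fun do rewrite big1_eq; exact: cvg_cst.
  have stripE : \bigcup_k strip (A k) t r = strip (\bigcup_k A k) t r.
    apply/seteqP; split => [p [k _ [Ap rp]]|p [[k _ Ap] rp]]; last by exists k.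
    by split => //; exists k.
  rewrite -stripE; case: hx => _ /(_ [fset t; r]%fset (fun k => strip (A k) t r)).
  apply; last by rewrite stripE; exact: elementary_strip.
    by move=> k; exact: elementary_strip.
  move=> i j _ _ [p [[Ai _] [Aj _]]]; apply: tA => //.
  by exists p.1.
have /cvgrPdist_le /(_ _ e3) := tcvg; apply: filterS => N hN.
have h1 := limit_measure_dist n t (Fm FUA).
have h2 := limit_measure_dist n t (mS N); rewrite distrC in h2.
have h3 := ler_distD (tail n t (\bigcup_k A k)) (limit_measure t (\bigcup_k A k))
  (limit_measure t (S N)).
have h4 := ler_distD (tail n t (S N)) (tail n t (\bigcup_k A k))
  (limit_measure t (S N)).
move: (n.+1%:R^-1 : R) hn h1 h2 => a hn h1 h2.
by apply: (le_trans h3); move: h1 h2 hN h4 hn; lra.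
Qed.

End limit_measures.
End potential_of_measure.

(** * Construction and uniqueness of the quasi-potential *)

Section correspondence.
Context {dO : measure_display} {Omega : measurableType dO} {R : realType}.
Context {dD : Order.disp_t} {Delta : orderType dD}.
Variables (P : probability Omega R) (F : Delta -> set (set Omega)).
Hypotheses (hF : filtration P F).
Variable t0 : Delta.
Implicit Types (X Y Z : Delta -> Omega -> R) (d : {fset Delta}).
Implicit Types (x y : set (Omega * Delta) -> R) (f : Omega * Delta -> R).
Implicit Types (s t : Delta).

Let sF t : sigma_algebra setT (F t). Proof. by case: hF. Qed.
Let Fm t : F t `<=` measurable. Proof. by case: hF. Qed.
Let sB := @sigma_algebra_barF _ Omega R _ Delta P.

(** [X t] is the density of [limit_measure x u t] on [F t]. Beyond [u n] this measure
    is at most [1 / (n + 1)] on each set, and [|X t|] is integrated separately where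
    [X t] is positive and where it is not, hence the bound [2 / (n + 1)]. *)
Lemma potential_of_measure x : Mloc P F x -> exists X,
  [/\ L1_process P F X, represents_increments P F x X,
      (exists C, forall t, \int[P]_w `|X t w| <= C),
      (exists u : nat -> Delta, forall n t, (u n <= t)%O ->
         \int[P]_w `|X t w| <= n.+1%:R^-1 + n.+1%:R^-1)
    & nonneg_on (barF P) x -> forall t, {ae P, forall w, 0 <= X t w}].
Proof.
move=> hx; have [bx _] := hx.
have /choice [u uP] : forall n : nat, exists u : Delta, forall C t, barF P C ->
    C `<=` setT `*` `]u, t]%classic -> `|x C| <= n.+1%:R^-1.
  by move=> n; apply: (ba_tail t0 bx); rewrite invr_gt0.
pose lam := limit_measure x u.
have lamP n t H : measurable H ->
    `|lam t H - x (strip H t (Order.max (u n) t))| <= n.+1%:R^-1.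
  by move=> mH; exact: (limit_measure_dist hx uP).
have /choice [X XP] : forall t, exists Z : Omega -> R, [/\ measurable_wrt (F t) Z,
    integrable_rv P Z & forall A, F t A -> \int[P]_(w in A) Z w = lam t A].
  move=> t; apply: density_sub_sigma_algebra => //.
    exact: (limit_measure_countably_additive hF hx uP).
  move=> N FN N0; apply: (limit_measure_null hx) => //; exact: Fm FN.
have mX t : measurable_wrt (F t) (X t) by case: (XP t).
have iX t : integrable_rv P (X t) by case: (XP t).
have lamX t A : F t A -> \int[P]_(w in A) X t w = lam t A by case: (XP t) => _ _; exact.
exists X; split.
- by split.
- move=> s t H st FH; have Ft : F t H by case: hF => _ _ Fle _; exact: Fle st _ FH.
  by rewrite !lamX// (limit_measure_increments hx uP st (Fm FH)).
- have [_ [M xM] _] := bx; exists ((M + 1) + (M + 1)) => t.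
  have lamM H : F t H -> `|lam t H| <= M + 1.
    move=> FH; have mH := Fm FH.
    rewrite -[lam t H](subrK (x (strip H t (Order.max (u 0%N) t)))) addrC.
    rewrite (le_trans (ler_normD _ _))// lerD//.
      by apply: xM; exact: barF_strip.
    by rewrite (le_trans (lamP 0%N _ _ mH))// invr1.
  have [F1 F2 ->] := Rintegral_norm_split (@Fm t) (mX t) (iX t).
  by rewrite !lamX// (le_trans (ler_norm _))// (le_trans (ler_normB _ _))// lerD// lamM.
- exists u => n t ut.
  have lamn H : F t H -> `|lam t H| <= n.+1%:R^-1.
    move=> FH; have := lamP n t H (Fm FH).
    by rewrite (max_r ut) (strip_empty bx) subr0.
  have [F1 F2 ->] := Rintegral_norm_split (@Fm t) (mX t) (iX t).
  by rewrite !lamX// (le_trans (ler_norm _))// (le_trans (ler_normB _ _))// lerD// lamn.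
- move=> x0 t.
  have iNX : integrable_rv P (fun w => - X t w).
    by have := integrable_rvZ (-1) (iX t); under eq_fun do rewrite mulN1r.
  have mNX : measurable_wrt (F t) (fun w => - X t w).
    exact: (measurable_wrt_comp (sF t) (@oppr_measurable R setT) (mX t)).
  have := Rintegral_le0_ae (@Fm t) mNX iNX; case=> [A FA|N [mN N0 DN]].
    have mA := Fm FA; under eq_Rintegral do rewrite -mulN1r.
    rewrite RintegralZl//; last exact: (integrableS measurableT mA (@subsetT _ A) (iX t)).
    rewrite mulN1r oppr_le0 lamX// /lam /limit_measure.
    apply: limr_ge; first exact: (tail_cvg hx uP).
    by apply: nearW => n; apply: x0; apply: barF_strip.
  by exists N; split => // w Xw; apply: DN => /=; rewrite oppr_le0.
Qed.

Lemma bounded_in_L1_le X C : (forall t, integrable_rv P (X t)) ->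
  (forall t, \int[P]_w `|X t w| <= C) -> bounded_in_L1 P X.
Proof.
move=> iX XC; apply: (@le_lt_trans _ _ C%:E); last exact: ltry.
apply: ge_ereal_sup => _ [t _ <-].
have iXt := integrable_fin_num measurableT (integrable_norm (iX t)).
by rewrite -[leLHS](fineK iXt) lee_fin; exact: XC.
Qed.

Lemma integrable_elementary_integral d X h : L1_process P F X ->
  (forall t, bounded_measurable measurable (fun w => h (w, t))) ->
  integrable_rv P (elementary_integral d h X).
Proof.
move=> hX bh; have iX := L1_integrable hX.
apply: integrable_rv_sum => st; apply: integrable_rvM => //.
exact: integrable_rvB.
Qed.

Lemma elementary_integral_linear d (a : R) X Y h w :
  elementary_integral d h (fun t w => a * X t w + Y t w) w =
  a * elementary_integral d h X w + elementary_integral d h Y w.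
Proof.
rewrite /elementary_integral mulr_sumr -big_split; apply: eq_bigr => st _ /=.
by ring.
Qed.

Hypothesis hP : measure_is_complete P.

Lemma approx_pairing_linear d f (a : R) X Y : bounded_measurable (barF P) f ->
  L1_process P F X -> L1_process P F Y ->
  approx_pairing P F d f (fun t w => a * X t w + Y t w) =
  a * approx_pairing P F d f X + approx_pairing P F d f Y.
Proof.
move=> bf hX hY; rewrite /approx_pairing.
have bh t : bounded_measurable measurable (fun w => elementary_proj P F d f (w, t)).
  apply: (bounded_measurable_section hP).
  exact: (bounded_measurable_elementary_proj hP hF d bf).
under eq_Rintegral do rewrite elementary_integral_linear.
have iX := integrable_elementary_integral d hX bh.
have iY := integrable_elementary_integral d hY bh.
by rewrite RintegralD// ?RintegralZl//; exact: integrable_rvZ.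
Qed.

(** The conditional expectation of [f] is measurable at the left endpoint of the
    step, hence orthogonal to the increments of a martingale. *)
Lemma approx_pairing_martingale d f Z : bounded_measurable (barF P) f ->
  martingale P F Z -> approx_pairing P F d f Z = 0.
Proof.
move=> bf [hZ mZ]; rewrite (approx_pairingE0 hP hF hZ d bf) big_seq big1// => -[s t] /= std.
have [_ _ st _] := steps_consecutive std.
have bc : bounded_measurable (F s) (cond_exp P (F s) (fun w => f (w, t))).
  apply: bounded_measurable_cond_exp => //.
  exact: (bounded_measurable_section hP t bf).
rewrite (Rintegral_drift hF hZ t bc); apply/eqP; rewrite subr_eq0; apply/eqP.
apply: (cond_exp_pull_out (sF s) (@Fm s)) => //; first exact: L1_integrable hZ t.
exact: mZ (ltW st).
Qed.

Lemma L1_processB X Y : L1_process P F X -> L1_process P F Y ->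
  L1_process P F (fun t w => X t w - Y t w).
Proof.
move=> [aX iX] [aY iY]; split => t; last exact: integrable_rvB.
exact: measurable_wrtB.
Qed.

Lemma martingale_of_increments x y X Y : L1_process P F X -> L1_process P F Y ->
  agree_on (barF P) x y -> represents_increments P F x X ->
  represents_increments P F y Y -> martingale P F (fun t w => X t w - Y t w).
Proof.
move=> hX hY xy xX yY; split; first exact: L1_processB.
move=> s t st; have hZ := L1_processB hX hY.
split; [by case: hZ|exact: L1_integrable hZ s|move=> A FA].
have mA := Fm FA; have iA := integrableS measurableT mA (@subsetT _ A).
have := xX _ _ _ st FA; rewrite xy ?yY//; last exact: barF_strip.
rewrite !RintegralB//; [lra| | | |]; apply: iA.
- exact: L1_integrable hX t.
- exact: L1_integrable hY t.
- exact: L1_integrable hX s.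
- exact: L1_integrable hY s.
Qed.

(** [P |Z_s|] is a difference of integrals of [Z_s] over two sets of [F s], where
    [Z_s] may be replaced by [Z_t]. *)
Lemma martingale_norm_le Z s t : martingale P F Z -> (s <= t)%O ->
  \int[P]_w `|Z s w| <= \int[P]_w `|Z t w|.
Proof.
move=> [hZ mZ] st; have [mZs iZs Est] := mZ s t st; have iZt := L1_integrable hZ t.
have [G1 G2 ->] := Rintegral_norm_split (@Fm s) mZs iZs.
rewrite !Est// (Rintegral_indic P [set w | 0 < Z s w]).
rewrite (Rintegral_indic P [set w | Z s w <= 0]).
have bG A : F s A -> bounded_measurable measurable (\1_A : Omega -> R).
  move=> GA; apply: bounded_measurable_indic; last exact: Fm GA.
  exact: sigma_algebra_measurable.
have i1 := integrable_rvM (bG _ G1) iZt; have i2 := integrable_rvM (bG _ G2) iZt.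
rewrite -RintegralB//; apply: le_Rintegral => //.
- exact: integrable_rvB i1 i2.
- exact: integrable_norm.
move=> w _; rewrite !indicE; have [Z0|Z0] := leP (Z s w) 0.
  rewrite memNset ?mem_set//; last by rewrite /= ltNge Z0.
  by rewrite mul0r mul1r sub0r -normrN ler_norm.
rewrite mem_set ?memNset//; last by rewrite /= leNgt Z0.
by rewrite mul0r mul1r subr0 ler_norm.
Qed.

Lemma ae_eq_modification X Y : (forall t, integrable_rv P (fun w => X t w - Y t w)) ->
  (forall t, \int[P]_w `|X t w - Y t w| <= 0) -> modification P X Y.
Proof.
move=> iZ Z0 t; have [N [mN N0 XYN]] := Rintegral_norm0_ae (iZ t) (Z0 t).
have nXY : P.-negligible (~` [set w | X t w = Y t w]).
  exists N; split => // w /= XYw; apply: XYN => /= /eqP; rewrite subr_eq0 => /eqP.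
  exact: XYw.
have mXY := hP nXY.
rewrite -[X in P X]setCK probability_setC// (_ : P _ = 0%E) ?sube0//.
exact/(negligibleP P mXY).
Qed.

(** A martingale that is a difference of quasi-potentials is 0, because
    [martingale_norm_le] compares its value at [t] with its values along the sequence
    on which the quasi-potentials vanish in the limit. *)
Lemma quasi_potential_unique X Y : quasi_potential P F X -> quasi_potential P F Y ->
  martingale P F (fun t w => X t w - Y t w) -> modification P X Y.
Proof.
move=> [[hX _] [u uX]] [[hY _] [v vY]] mZ.
have iZ := L1_integrable (L1_processB hX hY).
apply: ae_eq_modification => // t.
pose r n := Order.max t (Order.max (u n) (v n)).
have tr n : (t <= r n)%O by rewrite le_max lexx.
have Xr : \int[P]_w `|X (r n) w| @[n --> \oo] --> (0 : R).
  by apply: uX => n; rewrite !le_max lexx orbT.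
have Yr : \int[P]_w `|Y (r n) w| @[n --> \oo] --> (0 : R).
  by apply: vY => n; rewrite !le_max lexx !orbT.
have XYr : \int[P]_w `|X (r n) w| + \int[P]_w `|Y (r n) w| @[n --> \oo] --> (0 + 0 : R).
  exact: cvgD.
rewrite addr0 in XYr.
rewrite -(cvg_lim _ XYr)//; apply: limr_ge; first by apply/cvg_ex; exists 0.
apply: nearW => n /=; rewrite (le_trans (martingale_norm_le mZ (tr n)))//.
have iX := integrable_norm (L1_integrable hX (r n)).
have iY := integrable_norm (L1_integrable hY (r n)).
rewrite -RintegralD//; apply: le_Rintegral => //.
- exact: integrable_norm (iZ _).
- exact: integrable_rvD iX iY.
- by move=> w _; exact: ler_normB.
Qed.

End correspondence.

(** * The correspondence *)

Section quasi_potentials_of_measures.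
Context {dO : measure_display} {Omega : measurableType dO} {R : realType}.
Context {dD : Order.disp_t} {Delta : orderType dD}.
Variables (P : probability Omega R) (F : Delta -> set (set Omega)).
Variable L : ({fset Delta} -> R) -> R.
Hypotheses (hP : measure_is_complete P) (hF : filtration P F).
Hypothesis hL : banach_limit L.
Variable t0 : Delta.
Implicit Types (X Y : Delta -> Omega -> R) (x : set (Omega * Delta) -> R).

Lemma qm_measure_represents x X : Mloc P F x -> L1_process P F X ->
  represents_increments P F x X ->
  quasi_martingale P F X /\ locally_equal F x (qm_measure P F L X).
Proof.
move=> [bx _] hX xX; have qX := quasi_martingale_represented hF bx hX xX.
split=> //; have by_ := qm_measure_ba hP hF hL t0 qX.
by apply: (increments_locally_equal hF bx by_ xX); exact: qm_measure_increments.
Qed.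

Lemma quasi_potential_of_measure x : Mloc P F x -> exists X,
  [/\ quasi_potential P F X, bounded_in_L1 P X, represents_increments P F x X,
      locally_equal F x (qm_measure P F L X)
    & nonneg_on (barF P) x -> potential P F X].
Proof.
move=> hx; have [X [hX xX [C XC] [u uX] X0]] := potential_of_measure hF t0 hx.
have [qX xlX] := qm_measure_represents hx hX xX; have [bx _] := hx.
have qpX : quasi_potential P F X.
  split=> //; exists u => v uv; apply/cvgrPdist_le => e e0.
  have e2 : 0 < (e : R) / 2 by rewrite divr_gt0.
  apply: filterS (eps_small e2) => n en.
  rewrite sub0r normrN ger0_norm; last exact: Rintegral_ge0.
  by rewrite (le_trans (uX n _ (uv n)))// (splitr (e : R)) lerD.
exists X; split => //.
  exact: bounded_in_L1_le (L1_integrable hX) XC.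
move=> x0; split => //; last exact: X0.
exact: (supermartingale_represented hF hX xX).
Qed.

End quasi_potentials_of_measures.

Theorem theorem1 (R : realType) (dO : measure_display)
    (Omega : measurableType dO) (P : probability Omega R)
    (dD : Order.disp_t) (Delta : orderType dD) (t0 : Delta)
    (F : Delta -> set (set Omega)) (L : ({fset Delta} -> R) -> R)
    (hP : measure_is_complete P) (hF : filtration P F) (hL : banach_limit L) :
  (* the isometric isomorphism determined by the identity *)
  (exists Phi : (Delta -> Omega -> R) -> (set (Omega * Delta) -> R),
    [/\ forall X, quasi_martingale P F X ->
          Mloc_lim P F L (Phi X) /\
          (forall x, ba P x ->
             (corresponds P F L x X <-> agree_on (barF P) x (Phi X))),
        forall (a : R) X Y, quasi_martingale P F X -> quasi_martingale P F Y ->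
          agree_on (barF P) (Phi (fun t w => a * X t w + Y t w))
                (fun A => a * Phi X A + Phi Y A),
        forall X, quasi_martingale P F X ->
          fa_variation (barF P) (Phi X) = quasi_norm P F X,
        forall X Y, quasi_martingale P F X -> quasi_martingale P F Y ->
          (agree_on (barF P) (Phi X) (Phi Y) <->
           martingale P F (fun t w => X t w - Y t w))
      & forall x, Mloc_lim P F L x ->
          exists2 X, quasi_martingale P F X & agree_on (barF P) (Phi X) x])
  /\
  (* every locally countably additive measure is represented *)
  (forall x, Mloc P F x ->
    exists y, [/\ Mloc_lim P F L y, locally_equal F x y,
      (fa_variation (barF P) y <= fa_variation (barF P) x)%E,
      nonneg_on (barF P) x -> nonneg_on (barF P) y
    & forall z, Mloc_lim P F L z -> locally_equal F x z ->
        agree_on (barF P) y z])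
  /\
  (* (i) *)
  (forall x, Mloc_lim P F L x ->
    exists X, [/\ quasi_potential P F X, bounded_in_L1 P X,
      corresponds P F L x X
    & forall Y, quasi_potential P F Y -> bounded_in_L1 P Y ->
        corresponds P F L x Y -> modification P X Y])
  /\
  (* (ii) *)
  (forall x, ba P x ->
    ((Mloc_lim P F L x /\ nonneg_on (barF P) x) <->
     exists X, [/\ potential P F X, bounded_in_L1 P X
                 & corresponds P F L x X])).
Proof.
have agree_qm x X : Mloc_lim P F L x -> quasi_martingale P F X ->
    locally_equal F x (qm_measure P F L X) ->
    agree_on (barF P) x (qm_measure P F L X).
  move=> hx qX.
  exact: (Mloc_lim_unique hP hF hx (qm_measure_Mloc_lim hP hF hL t0 qX)).
split; [|split; [|split]].
- exists (qm_measure P F L); split.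
  + move=> X qX; split; first exact: (qm_measure_Mloc_lim hP hF hL t0).
    by move=> x bx; exact: (corresponds_qm_measure hP hF hL t0).
  + move=> a X Y qX qY A mA; have [hX _] := qX; have [hY _] := qY.
    have bA : bounded_measurable (barF P) (\1_A : _ -> R).
      by apply: bounded_measurable_indic => //; exact: sigma_algebra_barF.
    rewrite /qm_measure /qm_functional mulrN -opprD; congr (- _).
    case: (hL) => lin _ _; rewrite -lin; last 2 first.
    * exact: (bounded_approx_pairing hP hF t0).
    * exact: (bounded_approx_pairing hP hF t0).
    by congr L; apply/funext => d; exact: approx_pairing_linear.
  + move=> X qX; have [hX _] := qX; apply/eqP; rewrite eq_le; apply/andP; split.
      exact: fa_variation_qm_measure_le.
    apply: (quasi_norm_le_fa_variation hF _ hX).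
      exact: (qm_measure_ba hP hF hL t0).
    exact: (qm_measure_increments hP hF hL t0).
  + move=> X Y qX qY; have [hX _] := qX; have [hY _] := qY; split => [XY|mXY].
      apply: (martingale_of_increments hF hX hY XY).
        exact: (qm_measure_increments hP hF hL t0).
      exact: (qm_measure_increments hP hF hL t0).
    move=> A mA; congr (- L _); apply/funext => d.
    have bA : bounded_measurable (barF P) (\1_A : _ -> R).
      by apply: bounded_measurable_indic => //; exact: sigma_algebra_barF.
    have E : (fun t w => X t w - Y t w) = fun t w => (-1) * Y t w + X t w.
      by apply/funext => t; apply/funext => w; rewrite mulN1r addrC.
    have := approx_pairing_martingale hF hP d bA mXY.
    by rewrite E approx_pairing_linear// mulN1r addrC => /eqP; rewrite subr_eq0 => /eqP.
  + move=> x hx; have [hx' _] := hx.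
    have [X [[qX _] _ _ xX _]] := quasi_potential_of_measure hP hF hL t0 hx'.
    by exists X => // A mA; rewrite (agree_qm x X).
- move=> x hx; have [bx _] := hx.
  have [X [[qX _] _ xX xlX Xpot]] := quasi_potential_of_measure hP hF hL t0 hx.
  have [hX _] := qX.
  have lX := qm_measure_Mloc_lim hP hF hL t0 qX.
  exists (qm_measure P F L X); split => //.
  + apply: le_trans (quasi_norm_le_fa_variation hF bx hX xX).
    exact: fa_variation_qm_measure_le.
  + by move=> /Xpot[_ sX _]; exact: (qm_measure_nonneg hP hF hL t0).
  + move=> z hz xz; apply: (Mloc_lim_unique hP hF lX hz).
    by move=> d A EA; rewrite -(xlX d A EA); exact: (xz d A EA).
- move=> x hx; have [hx' _] := hx; have [bx _] := hx'.
  have [X [qpX bX xX xlX _]] := quasi_potential_of_measure hP hF hL t0 hx'.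
  have [qX _] := qpX; have [hX _] := qX; have agX := agree_qm x X hx qX xlX.
  exists X; split => //; first exact/(corresponds_qm_measure hP hF hL t0).
  move=> Y qpY _ /(corresponds_qm_measure hP hF hL t0 qpY.1 bx) agY.
  have [qY _] := qpY; have [hY _] := qY.
  apply: (quasi_potential_unique hF hP qpX qpY).
  apply: (@martingale_of_increments _ _ _ _ _ _ _ hF (qm_measure P F L X)
    (qm_measure P F L Y) _ _ hX hY).
  + by move=> A mA; rewrite -agX// agY.
  + exact: (qm_measure_increments hP hF hL t0).
  + exact: (qm_measure_increments hP hF hL t0).
- move=> x bx; split => [[hx x0]|[X [pX bX]]].
    have [hx' _] := hx.
    have [X [qpX bX xX xlX Xpot]] := quasi_potential_of_measure hP hF hL t0 hx'.
    have [qX _] := qpX; exists X; split => //; first exact: Xpot.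
    by apply/(corresponds_qm_measure hP hF hL t0 qX bx); exact: agree_qm.
  have [[qX _] sX _] := pX.
  move=> /(corresponds_qm_measure hP hF hL t0 qX bx) agX; split.
    apply: (Mloc_lim_agree hP hF (agree_on_sym agX)).
    exact: (qm_measure_Mloc_lim hP hF hL t0).
  by move=> A mA; rewrite agX//; exact: (qm_measure_nonneg hP hF hL t0).
Qed.
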